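(* Let $R$ be a non-discrete irreducible, continuous ring. Then every action of the unit group $\mathrm{GL}(R)$ by isometries on a non-empty complete $\mathrm{CAT}(0)$ space admits a fixed point. In particular, $\mathrm{GL}(R)$ has Serre's properties $(FH)$ and $(FA)$.
   Context: All rings are associative and unital. A ring $R$ is (von Neumann) regular if for every $a \in R$ there is $b \in R$ with $aba = a$. For a regular ring $R$, the set $\mathrm{L}(R) = \{ aR \mid a \in R \}$ of principal right ideals, ordered by inclusion, is a complemented modular lattice. A continuous ring is a regular ring $R$ such that the lattice $\mathrm{L}(R)$ is complete and satisfies $I \wedge \bigvee C = \bigvee \{ I \wedge J \mid J \in C\}$ and $I \vee \bigwedge C = \bigwedge \{ I \vee J \mid J \in C\}$ for every chain $C \subseteq \mathrm{L}(R)$ and every $I \in \mathrm{L}(R)$. A ring is irreducible if it is non-zero and not isomorphic to a direct product of two non-zero rings. $\mathrm{E}(R) = \{ e \in R \mid e^2 = e \}$; $e,f \in \mathrm{E}(R)$ are orthogonal if $ef=fe=0$. A rank function on a regular ring $R$ is a map $\rho \colon R \to [0,1]$ such that $\rho(1)=1$; $\rho(ab) \leq \min\{\rho(a),\rho(b)\}$ for all $a,b \in R$; $\rho(e+f) = \rho(e)+\rho(f)$ for orthogonal $e,f \in \mathrm{E}(R)$; and $\rho(a) > 0$ for all $a \in R \setminus \{0\}$. By von Neumann, every irreducible, continuous ring $R$ admits a unique rank function, denoted $\mathrm{rk}_R$, and $d_R(a,b) = \mathrm{rk}_R(a-b)$ is a (complete) metric on $R$. The ring $R$ is called discrete if the topology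 on $R$ generated by $d_R$ is discrete, and non-discrete otherwise. $\mathrm{GL}(R)$ is the group of units of $R$. A group $G$ has Serre's property $(FH)$ if every action of $G$ by isometries on a real Hilbert space has a fixed point, and Serre's property $(FA)$ if every action of $G$ by automorphisms on a tree fixes a vertex or an edge. *)

(* Defs.v *)
(* The field of real numbers is an arbitrary [K : realType]. *)
From HB Require Import structures.
From mathcomp Require Import all_boot all_order all_algebra.
From mathcomp Require Import all_classical all_reals all_analysis.

Set Implicit Arguments.
Unset Strict Implicit.
Unset Printing Implicit Defensive.

Import Order.TTheory GRing.Theory Num.Theory.
Import numFieldNormedType.Exports.

Local Open Scope classical_set_scope.
Local Open Scope ring_scope.

Definition regular_ring (R : pzRingType) : Prop :=
  forall a : R, exists b : R, a * b * a = a.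

(* L(R) = { aR | a in R }; it is ordered by inclusion. *)
Definition principal_right_ideals (R : pzRingType) : set (set R) :=
  [set range ( *%R a) | a in [set: R]].
Arguments principal_right_ideals R : clear implicits.

(* Suprema and infima taken inside the family [L] ordered by inclusion: they
   have to belong to [L], and need not be unions or intersections. *)
Definition is_join (T : Type) (L C : set (set T)) (J : set T) : Prop :=
  [/\ L J,
      forall I, C I -> I `<=` J
    & forall J', L J' -> (forall I, C I -> I `<=` J') -> J `<=` J'].

Definition is_meet (T : Type) (L C : set (set T)) (M : set T) : Prop :=
  [/\ L M,
      forall I, C I -> M `<=` I
    & forall M', L M' -> (forall I, C I -> M' `<=` I) -> M' `<=` M].

Definition complete_lattice (T : Type) (L : set (set T)) : Prop :=
  forall C, C `<=` L -> (exists J, is_join L C J) /\ (exists M, is_meet L C M).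

Definition chain_meet_continuous (T : Type) (L : set (set T)) : Prop :=
  forall (C : set (set T)) (I S M : set T),
    C `<=` L -> total_on C subset -> L I ->
    is_join L C S -> is_meet L [set I; S] M ->
    is_join L [set N | exists2 J, C J & is_meet L [set I; J] N] M.

Definition chain_join_continuous (T : Type) (L : set (set T)) : Prop :=
  forall (C : set (set T)) (I S M : set T),
    C `<=` L -> total_on C subset -> L I ->
    is_meet L C S -> is_join L [set I; S] M ->
    is_meet L [set N | exists2 J, C J & is_join L [set I; J] N] M.

Definition continuous_ring (R : pzRingType) : Prop :=
  [/\ regular_ring R,
      complete_lattice (principal_right_ideals R),
      chain_meet_continuous (principal_right_ideals R)
    & chain_join_continuous (principal_right_ideals R)].

Definition irreducible_ring (R : pzRingType) : Prop :=
  (1 : R) <> 0 /\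
  ~ exists (S T : nzRingType) (f : {rmorphism R -> (S * T)%type}), bijective f.

Definition idempotent_elt (R : pzRingType) (e : R) : Prop := e * e = e.

Definition orthogonal_elts (R : pzRingType) (e f : R) : Prop :=
  e * f = 0 /\ f * e = 0.

Definition rank_function (K : realType) (R : pzRingType) (rk : R -> K) : Prop :=
  [/\ forall a, 0 <= rk a <= 1,
      rk 1 = 1,
      forall a b, rk (a * b) <= Num.min (rk a) (rk b),
      forall e f, idempotent_elt e -> idempotent_elt f -> orthogonal_elts e f ->
        rk (e + f) = rk e + rk f
    & forall a, a <> 0 -> 0 < rk a].

Definition rank_dist (K : realType) (R : pzRingType) (rk : R -> K) (a b : R)
  : K := rk (a - b).

Definition dist_open (K : realType) (T : Type) (d : T -> T -> K) (U : set T)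
  : Prop := forall x, U x -> exists2 r : K, 0 < r & [set y | d x y < r] `<=` U.

Definition discrete_dist (K : realType) (T : Type) (d : T -> T -> K) : Prop :=
  forall U : set T, dist_open d U.

(* [rk] stands for the rank function of an irreducible, continuous ring, which
   is unique by von Neumann. *)
Definition discrete_ring (K : realType) (R : pzRingType) (rk : R -> K) : Prop :=
  discrete_dist (rank_dist rk).

(* The group of units, as for [{unit R}] but without finiteness of [R].  The
   [unitRingType] structure only excludes the zero ring: classically, any
   other ring carries it, with [GRing.unit] the two-sided invertible elements. *)
Section UnitGroup.
Variable R : unitRingType.

Inductive GL := GLUnit (x : R) of x \is a GRing.unit.
Definition GLval (u : GL) : R := let: GLUnit x _ := u in x.

HB.instance Definition _ := [isSub for GLval].
HB.instance Definition _ := [Choice of GL by <:].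

Implicit Types u v : GL.

Definition GL_one : GL := GLUnit (@GRing.unitr1 R).
Fact GL_inv_subproof u : (val u)^-1 \is a GRing.unit.
Proof. by rewrite unitrV (valP u). Qed.
Definition GL_inv u : GL := GLUnit (GL_inv_subproof u).
Fact GL_mul_subproof u v : val u * val v \is a GRing.unit.
Proof. by rewrite (unitrMr _ (valP u)) (valP v). Qed.
Definition GL_mul u v : GL := GLUnit (GL_mul_subproof u v).

Fact GL_mulA : associative GL_mul.
Proof. by move=> u v w; apply/val_inj/mulrA. Qed.
Fact GL_mul1g : left_id GL_one GL_mul.
Proof. by move=> u; apply/val_inj/mul1r. Qed.
Fact GL_mulg1 : right_id GL_one GL_mul.
Proof. by move=> u; apply/val_inj/mulr1. Qed.
Fact GL_mulVg : left_inverse GL_one GL_inv GL_mul.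
Proof. by move=> u; apply/val_inj/(mulVr (valP u)). Qed.
Fact GL_mulgV : right_inverse GL_one GL_inv GL_mul.
Proof. by move=> u; apply/val_inj/(mulrV (valP u)). Qed.

HB.instance Definition _ :=
  isGroup.Build GL GL_mulA GL_mul1g GL_mulg1 GL_mulVg GL_mulgV.
End UnitGroup.

Definition group_action (G : groupType) (X : Type) (act : G -> X -> X) : Prop :=
  (forall x, act 1%g x = x) /\
  (forall g h x, act (g * h)%g x = act g (act h x)).

Definition isometric_action (K : realType) (G : groupType) (X : Type)
    (d : X -> X -> K) (act : G -> X -> X) : Prop :=
  group_action act /\ forall g x y, d (act g x) (act g y) = d x y.

Definition has_fixed_point (G : groupType) (X : Type) (act : G -> X -> X)
  : Prop := exists x, forall g, act g x = x.

Definition complete_space (X : uniformType) : Prop :=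
  forall F : set_system X, ProperFilter F -> cauchy F -> exists x : X, F --> x.

(* The library's norm on ['rV[K]_2] is the sup norm, hence this definition. *)
Definition eucl_dist (K : realType) (u v : 'rV[K]_2) : K :=
  Num.sqrt (\sum_(i < 2) (u 0 i - v 0 i) ^+ 2).

Definition geodesic (K : realType) (X : metricType K) (c : K -> X) (x y : X)
  : Prop :=
  [/\ c 0 = x,
      c (mdist x y) = y
    & {in `[0, mdist x y] &, forall s t, mdist (c s) (c t) = `|s - t|}].

Definition geodesic_space (K : realType) (X : metricType K) : Prop :=
  forall x y : X, exists c, geodesic c x y.

(* [p', q', r'] are the vertices of a comparison triangle for [p, q, r]. *)
Definition comparison_triangle (K : realType) (X : metricType K)
    (p q r : X) (p' q' r' : 'rV[K]_2) : Prop :=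
  [/\ eucl_dist p' q' = mdist p q,
      eucl_dist q' r' = mdist q r
    & eucl_dist p' r' = mdist p r].

(* For [x] on a geodesic from [p] to [q], [x'] is the corresponding point of
   the Euclidean segment [p', q']: its distances to [p'] and [q'] add up to the
   length of the segment, so that it lies on it. *)
Definition comparison_point (K : realType) (X : metricType K)
    (p q x : X) (p' q' x' : 'rV[K]_2) : Prop :=
  eucl_dist p' x' = mdist p x /\ eucl_dist x' q' = mdist x q.

(* Triangles in a CAT(0) space are not thicker than their comparison triangles.
   It suffices to compare points on two sides issuing from a common vertex [p]:
   [p] is arbitrary, and two points of one side are always at the same distance
   as their comparison points. *)
Definition CAT0 (K : realType) (X : metricType K) : Prop :=
  geodesic_space X /\
  forall (p q r : X) (c1 c2 : K -> X) (p' q' r' : 'rV[K]_2),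
    geodesic c1 p q -> geodesic c2 p r -> comparison_triangle p q r p' q' r' ->
    forall (s t : K) (x' y' : 'rV[K]_2),
      s \in `[0, mdist p q] -> t \in `[0, mdist p r] ->
      comparison_point p q (c1 s) p' q' x' ->
      comparison_point p r (c2 t) p' r' y' ->
      mdist (c1 s) (c2 t) <= eucl_dist x' y'.

(* A real Hilbert space is a complete normed space over [K] whose norm comes
   from an inner product [ip]. *)
Definition property_FH (K : realType) (G : groupType) : Prop :=
  forall (H : completeNormedModType K) (ip : {dot H for idfun}),
    (forall x : H, ip x x = `|x| ^+ 2) ->
    forall act : G -> H -> H,
      isometric_action (fun x y : H => `|x - y|) act -> has_fixed_point act.

(* Simple graphs, possibly infinite; a tree is non-empty and connected and has
   no cycle of length at least 3. *)
Definition is_tree (V : eqType) (e : rel V) : Prop :=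
  [/\ irreflexive e,
      symmetric e,
      inhabited V,
      forall x y : V, exists2 p : seq V, path e x p & last x p = y
    & forall p : seq V, ucycle e p -> (size p <= 2)%N].

Definition fixes_edge (G : groupType) (V : eqType) (e : rel V)
    (act : G -> V -> V) : Prop :=
  exists x y : V, e x y /\
    forall g, (act g x = x /\ act g y = y) \/ (act g x = y /\ act g y = x).

Definition property_FA (G : groupType) : Prop :=
  forall (V : eqType) (e : rel V), is_tree e ->
  forall act : G -> V -> V,
    group_action act -> (forall g x y, e (act g x) (act g y) = e x y) ->
    has_fixed_point act \/ fixes_edge e act.

(* Main.v *)
(* Every length function [l] on [GL R] is bounded, so all orbits of an isometric
   action are bounded; a bounded orbit in a complete CAT(0) space or a Hilbert
   space has a circumcenter, and in a tree the vertices minimising the largest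
   distance to the orbit form a vertex or an edge.

   Boundedness of [l] is a Bergman-type argument.  Meet-continuity of L(R) allows
   one to glue a chain of partial isomorphisms (the join of their graphs is a
   graph), which gives halving and comparison of idempotents, hence stable
   range one, and infinite block-diagonal elements.  Choose orthogonal
   idempotents [f_n] of rank 2^-(n+2).  By a diagonal argument, for some [n] every
   unit of [f_n R f_n] extends to a unit of [R] of length at most [N]; so, with
   [f = f_n], all commutators [u, z] with [u] a unit of [fRf] and [z] fixed have
   bounded length.  An infinite swindle writes each unit of a smaller corner
   [gRg] as a product of boundedly many such commutators: a unit of [gRg] is
   elementary times one living on half of [g], and, repeating this, the block
   sums [u_0, u_1, ...] and [u_1, u_2, ...] differ by a conjugation.  Finally
   the bound passes from corners of rank [r] to corners of rank [2r]. *)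
Require Import Defs.
From HB Require Import structures.
From mathcomp Require Import all_boot all_order all_algebra.
From mathcomp Require Import all_classical all_reals all_analysis.
From mathcomp Require Import ring lra zify.
From Stdlib Require Ncring Ncring_tac.

Set Implicit Arguments.
Unset Strict Implicit.
Unset Printing Implicit Defensive.

Import Order.TTheory GRing.Theory Num.Theory.
Import numFieldNormedType.Exports.

Local Open Scope classical_set_scope.
Local Open Scope ring_scope.

(** * Principal right ideals of a regular ring *)

(** Graphs have to be represented inside [R] itself: the map [a] on [kR] is coded by the right ideal
    [(1 + a)kR], from which [a] can be recovered if [kR] and [akR] are independent. Hence partial
    isomorphisms carry an independence condition, comparison of idempotents goes through the
    independent case, and block sums are formed under an idempotent [E] of rank at most 1/2, which
    leaves a disjoint copy of [ER] to serve as target. The rank supplies finiteness: a subidempotent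
    of full rank is everything, so one-sided inverses in corners are two-sided and complements of
    equal rank are isomorphic. The bounds are uniform because each commutator has one entry fixed in
    advance, on which its bound may depend; the factorisations are arranged so that the varying unit
    is always the other entry. *)

#[global] Instance ncring_ops (R : pzRingType) :
  @Ncring.Ring_ops R 0 1 (@GRing.add R) (@GRing.mul R) (fun x y => x - y)
    (@GRing.opp R) (@eq R) := {}.

#[global] Instance ncring_ring (R : pzRingType) :
  Ncring.Ring (Ro := ncring_ops R).
Proof.
split; try (by move=> ? ? -> ? ? ->); try (by move=> ? ? ->).
- exact: RelationClasses.eq_equivalence.
- exact: (@add0r R).
- exact: (@addrC R).
- exact: (@addrA R).
- exact: (@mul1r R).
- exact: (@mulr1 R).
- exact: (@mulrA R).
- by move=> *; exact: (@mulrDl R).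
- by move=> *; exact: (@mulrDr R).
- by [].
- exact: (@subrr R).
Qed.

Ltac ncring := Ncring_tac.non_commutative_ring.

Definition ncE (R : pzRingType) :=
  (@mulrDl R, @mulrDr R, @mulrBl R, @mulrBr R, @mulrN R, @mulNr R,
   @mulrA R, @mul1r R, @mulr1 R, @mul0r R, @mulr0 R).

(* Lets [rewrite] use [x * y = z] inside the left-nested products left by [ncE]. *)
Lemma mulE (R : pzRingType) (x y z : R) :
  x * y = z -> (x * y = z) * (forall w, w * x * y = w * z).
Proof. by move=> H; split=> // w; rewrite -mulrA H. Qed.

Section RegularRing.
Variable R : pzRingType.
Implicit Types a b e f g k x y : R.

Definition ridl a : set R := [set x | exists y, x = a * y].

Lemma ridl_self a : ridl a a.
Proof. by exists 1; rewrite mulr1. Qed.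

Lemma ridlM a x y : ridl a x -> ridl a (x * y).
Proof. by move=> [z ->]; exists (z * y); rewrite mulrA. Qed.

Lemma ridlP e x : e * e = e -> ridl e x <-> e * x = x.
Proof.
by move=> ee; split=> [[y ->]|<-]; [rewrite mulrA ee|exists x].
Qed.

Lemma ridl_sub a b : ridl b a -> ridl a `<=` ridl b.
Proof. by move=> ba x [y ->]; apply: ridlM. Qed.

Lemma sub_ridl a b : ridl a `<=` ridl b -> ridl b a.
Proof. by apply; apply: ridl_self. Qed.

Lemma principal_ridl a : principal_right_ideals R (ridl a).
Proof.
exists a => //; apply/seteqP; split=> x.
  by move=> [y _ <-]; exists y.
by move=> [y ->]; exists y.
Qed.

Lemma principal_ridlP I : principal_right_ideals R I -> exists a, I = ridl a.
Proof.
move=> [a _ <-]; exists a; apply/seteqP; split=> x.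
  by move=> [y _ <-]; exists y.
by move=> [y ->]; exists y.
Qed.

(* Suprema in [L(R)], tested by annihilators: in a regular ring the right
   annihilator of an element is a principal right ideal. *)
Definition join_of (I : Type) (f : I -> R) e :=
  [/\ e * e = e, forall i, e * f i = f i
    & forall a, (forall i, a * f i = 0) -> a * e = 0].

Definition chain (I : Type) (f : I -> R) :=
  forall i j, ridl (f j) (f i) \/ ridl (f i) (f j).

Definition independent a b := forall x, ridl a x -> ridl b x -> x = 0.

Lemma independentC a b : independent a b -> independent b a.
Proof. by move=> H x ? ?; apply: H. Qed.

Lemma independentS a b a' b' :
  ridl a a' -> ridl b b' -> independent a b -> independent a' b'.
Proof. by move=> /ridl_sub Ha /ridl_sub Hb H x /Ha ? /Hb ?; apply: H. Qed.

Hypothesis reg : regular_ring R.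

Lemma ridl_idem a : exists e, [/\ e * e = e, e * a = a & ridl a e].
Proof.
have [b aba] := reg a; exists (a * b); split=> //; last by exists b.
by rewrite mulrA aba.
Qed.

Lemma ridl_idem_eq a : exists2 e, e * e = e & ridl a = ridl e.
Proof.
have [e [ee ea ae]] := ridl_idem a; exists e => //.
by apply/seteqP; split; apply: ridl_sub => //; apply/(ridlP _ ee).
Qed.

Lemma annihilator_ridl a :
  exists g, [/\ g * g = g, a * g = 0 & forall x, a * x = 0 -> ridl g x].
Proof.
have [b aba] := reg a; exists (1 - b * a).
have bab : b * a * (b * a) = b * a by rewrite -mulrA (mulrA a) aba.
split.
- by rewrite mulrBl mul1r mulrBr mulr1 bab subrr subr0.
- by rewrite mulrBr mulr1 mulrA aba subrr.
- by move=> x ax; exists x; rewrite mulrBl mul1r -mulrA ax mulr0 subr0.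
Qed.

(** Independence makes left multiplication by [1 - e], where [aR = eR], injective on [bR]; a
    quasi-inverse of [(1 - e) * b] undoes it there. *)
Lemma independent_split a b :
  independent a b -> exists c, c * a = 0 /\ c * b = b.
Proof.
move=> dab; have [e [ee ea ae]] := ridl_idem a.
have [c Hc] := reg ((1 - e) * b).
exists (b * c * (1 - e)); split; first by rewrite -mulrA mulrBl mul1r ea subrr mulr0.
apply/eqP; rewrite -subr_eq0; apply/eqP; apply: dab; last first.
  by exists (c * (1 - e) * b - 1); rewrite !ncE.
apply: (ridl_sub ae); apply/(ridlP _ ee)/eqP.
rewrite eq_sym -subr_eq0; apply/eqP; move: Hc; rewrite !ncE => Hc.
rewrite -[RHS](subrr (b - e * b)) -{1}Hc; ncring.
Qed.

Lemma independent_idem_split e p q : e * e = e -> p * p = p ->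
  e * p = p -> e * q = q -> independent p q ->
  exists p' q', [/\ p' * p' = p', q' * q' = q', p' * q' = 0, q' * p' = 0
    & [/\ ridl p = ridl p', ridl q = ridl q',
          e * p' = p' /\ p' * e = p' & e * q' = q' /\ q' * e = q']].
Proof.
move=> ee pp ep eq0 dpq.
have [q1 q1q1 qq1] := ridl_idem_eq q.
have eq1 : e * q1 = q1.
  have [y ->] : ridl q q1 by rewrite qq1; apply: ridl_self.
  by rewrite mulrA eq0.
have {}dpq : independent p q1.
  by move=> x ? ?; apply: dpq => //; rewrite qq1.
have [c [cp cq]] := independent_split dpq.
have [d [dq dp]] := independent_split (independentC dpq).
have idem_eq u v : u * u = u -> v * v = v -> u * v = v -> v * u = u ->
    ridl u = ridl v.
  by move=> uu vv uv vu; apply/seteqP; split; apply: ridl_sub; apply/ridlP.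
exists (p * d * e), (q1 * c * e).
have E1 := (mulE ee, mulE pp, mulE q1q1, mulE ep, mulE eq1, mulE cp, mulE cq,
            mulE dq, mulE dp).
split; try by rewrite !ncE !E1 ?ncE ?E1.
rewrite qq1; split.
- by apply: idem_eq; rewrite // ?ncE ?E1.
- by apply: idem_eq; rewrite // ?ncE ?E1.
- by split; rewrite ?ncE ?E1.
- by split; rewrite ?ncE ?E1.
Qed.

Section Lattice.
Hypothesis cmpl : complete_lattice (principal_right_ideals R).
Hypothesis mcont : chain_meet_continuous (principal_right_ideals R).

Lemma join_exists (I : Type) (f : I -> R) : exists e, join_of f e.
Proof.
pose C := [set J | exists i, J = ridl (f i)].
have CL : C `<=` principal_right_ideals R.
  by move=> _ [i ->]; apply: principal_ridl.
have [[J [LJ ubJ lubJ]] _] := cmpl CL.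
have [j Jj] := principal_ridlP LJ.
have [e ee je] := ridl_idem_eq j; rewrite {}Jj {}je in LJ ubJ lubJ.
exists e; split=> //.
  by move=> i; apply/(ridlP _ ee)/(ubJ (ridl (f i))); [exists i|apply: ridl_self].
move=> a af; have [g [gg ag Hg]] := annihilator_ridl a.
have : ridl g e.
  apply: sub_ridl; apply: lubJ; first exact: principal_ridl.
  by move=> _ [i ->]; apply: ridl_sub; apply: Hg.
by move=> [y ->]; rewrite mulrA ag mul0r.
Qed.

Lemma meet_exists a b : exists2 g, g * g = g &
  forall x, ridl g x <-> ridl a x /\ ridl b x.
Proof.
have CL : [set ridl a; ridl b] `<=` principal_right_ideals R.
  by move=> _ [->|->]; apply: principal_ridl.
have [_ [M [LM lbM glbM]]] := cmpl CL.
have [m Mm] := principal_ridlP LM.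
have [g gg mg] := ridl_idem_eq m; rewrite {}Mm {}mg in LM lbM glbM.
exists g => // x; split=> [gx|[ax bx]].
  by split; [apply: (lbM (ridl a))|apply: (lbM (ridl b))] => //; [left|right].
apply: sub_ridl; apply: glbM; first exact: principal_ridl.
by move=> _ [->|->]; apply: ridl_sub.
Qed.

(** By the chain axiom the meet of [eR] and [gR] is the join of the meets of the [f i R] with [gR];
    each of these lies in the right annihilator of [a], which is principal, so their join does
    too. *)
Lemma meet_continuous (I : Type) (f : I -> R) e g a :
  join_of f e -> chain f ->
  (forall i x, ridl (f i) x -> ridl g x -> a * x = 0) ->
  forall x, ridl e x -> ridl g x -> a * x = 0.
Proof.
move=> [ee ef eub] chf Hfg x ex gx.
pose C := [set J | exists i, J = ridl (f i)].
have CL : C `<=` principal_right_ideals R.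
  by move=> _ [i ->]; apply: principal_ridl.
have Cch : total_on C subset.
  by move=> _ _ [i ->] [j ->]; case: (chf i j) => H; [left|right]; apply: ridl_sub.
have Cj : is_join (principal_right_ideals R) C (ridl e).
  split; first exact: principal_ridl.
    by move=> _ [i ->]; apply: ridl_sub; apply/ridlP.
  move=> J' /principal_ridlP[j ->] ub; have [h hh jh] := ridl_idem_eq j.
  rewrite {}jh in ub *; apply: ridl_sub; apply/(ridlP _ hh)/eqP.
  rewrite eq_sym -subr_eq0 -{1}(mul1r e) -mulrBl; apply/eqP/eub => i.
  suff /(ridlP _ hh) : ridl h (f i) by rewrite mulrBl mul1r => ->; rewrite subrr.
  by apply: (ub (ridl (f i))); [exists i|apply: ridl_self].
have [m mm Hm] := meet_exists g e.
have meetP p q r : (forall y, ridl p y <-> ridl q y /\ ridl r y) ->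
    is_meet (principal_right_ideals R) [set ridl q; ridl r] (ridl p).
  move=> H; split; first exact: principal_ridl.
    by move=> _ [->|->] y /H[].
  by move=> M' LM' lb y M'y; apply/H; split; apply: (lb _ _ _ M'y); [left|right].
have [_ _ lub] := mcont CL Cch (principal_ridl g) Cj (meetP _ _ _ Hm).
have [h [hh ah Hh]] := annihilator_ridl a.
suff : ridl h x by move=> [y ->]; rewrite mulrA ah mul0r.
apply: (lub (ridl h)); first exact: principal_ridl; last exact/Hm.
move=> N [J [i ->]] [LN lbN glbN] y Ny; apply/Hh/(Hfg i).
  by apply: (lbN (ridl (f i))) => //; right.
by apply: (lbN (ridl g)) => //; left.
Qed.

Lemma join_independent (I : Type) (f : I -> R) e g :
  join_of f e -> chain f -> (forall i, independent (f i) g) -> independent e g.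
Proof.
move=> je chf dj x ex gx; rewrite -(mul1r x).
by apply: (meet_continuous je chf _ ex gx) => i y fy gy; rewrite mul1r; apply: (dj i).
Qed.

(** Meet continuity is applied to one family and then to the other. The families increase together,
    so for mixed indices [i] and [j] the larger one dominates both sides. *)
Lemma joins_independent (I : Type) (f r : I -> R) e h :
  join_of f e -> join_of r h ->
  (forall i j, (ridl (f j) (f i) /\ ridl (r j) (r i))
            \/ (ridl (f i) (f j) /\ ridl (r i) (r j))) ->
  (forall i, independent (f i) (r i)) -> independent e h.
Proof.
move=> je jh ch dj.
have chf : chain f by move=> i j; case: (ch i j) => -[]; [left|right].
have chr : chain r by move=> i j; case: (ch i j) => -[]; [left|right].
apply: (join_independent je chf) => i; apply: independentC.
apply: (join_independent jh chr) => j; apply: independentC.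
case: (ch i j) => -[H1 H2].
  by apply: independentS (dj j) => //; apply: ridl_self.
by apply: independentS (dj i) => //; apply: ridl_self.
Qed.

(* The graphs [(1 + a i) k i R] form a chain whose join still meets the join of
   the ranges [a i k i R] trivially, hence is itself a graph. *)
Lemma glue (I : Type) (k a : I -> R) :
  (forall i j, (k j * k i = k i /\ a j * k i = a i * k i)
            \/ (k i * k j = k j /\ a i * k j = a j * k j)) ->
  (forall i, independent (k i) (a i * k i)) ->
  exists b, forall i, b * k i = a i * k i.
Proof.
move=> ch dj.
pose f i := (1 + a i) * k i; pose r i := a i * k i.
have fS i j : k j * k i = k i -> a j * k i = a i * k i ->
    ridl (f j) (f i) /\ ridl (r j) (r i).
  move=> H1 H2; split; exists (k i); rewrite /f /r.
    by rewrite !ncE !(mulE H1) H2.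
  by rewrite -mulrA H1 H2.
have [e je] := join_exists f; have [h jh] := join_exists r.
have deh : independent e h.
  apply: (joins_independent je jh) => [i j|i x [y xy] [z xz]].
    by case: (ch i j) => -[H1 H2]; [left|right]; apply: fS.
  have : k i * y = 0.
    apply: (dj i); first by exists y.
    exists (z - y); rewrite mulrBr -/(r i) -xz xy /f /r !ncE.
    by ncring.
  by rewrite xy /f -mulrA => ->; rewrite mulr0.
have [c [ce ch0]] := independent_split deh.
have [_ ef _] := je; have [_ hr _] := jh.
(* The projection onto the ranges along the graphs kills [k i + a i * k i], so it sends [k i] to
   [- a i * k i]. *)
exists (- c) => i.
have c1 : c * r i = r i by rewrite -(hr i) mulrA ch0.
have : c * f i = 0 by rewrite -(ef i) mulrA ce mul0r.
rewrite /f !mulrDl mul1r mulrDr -/(r i) c1 mulNr => /eqP.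
by rewrite addr_eq0 => /eqP ->; rewrite opprK.
Qed.

End Lattice.
End RegularRing.

(** * Central idempotents *)

Section CentralCorner.
Variable R : pzRingType.

(** [central_neq0] is bundled because the corner [zR], with unit [z], must be a non-zero ring to
    count as a factor in [irreducible_ring]. *)
Record central_idem := CentralIdem {
  central_val : R;
  central_idemP : central_val * central_val = central_val;
  central_comm : forall x, central_val * x = x * central_val;
  central_neq0 : central_val != 0 }.

Variable z : central_idem.

Record corner := Corner { corner_val : R; _ : central_val z * corner_val == corner_val }.

HB.instance Definition _ := [isSub for corner_val].
HB.instance Definition _ := [Choice of corner by <:].

Implicit Types u v w : corner.

Let cornerP u : central_val z * val u = val u. Proof. exact/eqP/(valP u). Qed.

Fact corner0_subproof : central_val z * (0 : R) == 0. Proof. by rewrite mulr0. Qed.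
Fact cornerD_subproof u v : central_val z * (val u + val v) == val u + val v.
Proof. by rewrite mulrDr !cornerP. Qed.
Fact cornerN_subproof u : central_val z * (- val u) == - val u.
Proof. by rewrite mulrN cornerP. Qed.
Fact corner1_subproof : central_val z * central_val z == central_val z. Proof. by rewrite central_idemP. Qed.
Fact cornerM_subproof u v : central_val z * (val u * val v) == val u * val v.
Proof. by rewrite mulrA cornerP. Qed.

Definition corner0 := Corner corner0_subproof.
Definition cornerD u v := Corner (cornerD_subproof u v).
Definition cornerN u := Corner (cornerN_subproof u).
Definition corner1 := Corner corner1_subproof.
Definition cornerM u v := Corner (cornerM_subproof u v).

Fact cornerDA : associative cornerD.
Proof. by move=> *; apply/val_inj/addrA. Qed.
Fact cornerDC : commutative cornerD.
Proof. by move=> *; apply/val_inj/addrC. Qed.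
Fact corner0D : left_id corner0 cornerD.
Proof. by move=> *; apply/val_inj/add0r. Qed.
Fact cornerND : left_inverse corner0 cornerN cornerD.
Proof. by move=> *; apply/val_inj/addNr. Qed.

HB.instance Definition _ :=
  GRing.isZmodule.Build corner cornerDA cornerDC corner0D cornerND.

Fact cornerMA : associative cornerM.
Proof. by move=> *; apply/val_inj/mulrA. Qed.
Fact corner1M : left_id corner1 cornerM.
Proof. by move=> u; apply/val_inj/cornerP. Qed.
Fact cornerM1 : right_id corner1 cornerM.
Proof. by move=> u; apply/val_inj; rewrite /= -central_comm; apply: cornerP. Qed.
Fact cornerMDl : left_distributive cornerM cornerD.
Proof. by move=> *; apply/val_inj/mulrDl. Qed.
Fact cornerMDr : right_distributive cornerM cornerD.
Proof. by move=> *; apply/val_inj/mulrDr. Qed.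
Fact corner1_neq0 : corner1 != 0 :> corner.
Proof. by rewrite -val_eqE /= central_neq0. Qed.

HB.instance Definition _ := GRing.Zmodule_isNzRing.Build corner
  cornerMA corner1M cornerM1 cornerMDl cornerMDr corner1_neq0.

Fact corner_proj_subproof x : central_val z * (central_val z * x) == central_val z * x.
Proof. by rewrite mulrA central_idemP. Qed.
Definition corner_proj x : corner := Corner (corner_proj_subproof x).

End CentralCorner.

Section Peirce.
Variable R : pzRingType.
Variables z z' : central_idem R.
Hypothesis zz' : central_val z + central_val z' = 1.

Definition peirce (x : R) : (corner z * corner z')%type :=
  (corner_proj z x, corner_proj z' x).

Fact peirce_zmod : zmod_morphism peirce.
Proof. by move=> x y; congr pair; apply/val_inj; rewrite /= mulrBr. Qed.

Fact peirce_monoid : monoid_morphism peirce.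
Proof.
split; first by congr pair; apply/val_inj; rewrite /= mulr1.
move=> x y; congr pair; apply/val_inj; rewrite /= !mulrA;
  by rewrite -(mulrA _ x) -central_comm !mulrA central_idemP.
Qed.

HB.instance Definition _ := GRing.isZmodMorphism.Build _ _ peirce peirce_zmod.
HB.instance Definition _ := GRing.isMonoidMorphism.Build _ _ peirce peirce_monoid.

Lemma peirce_bij : bijective peirce.
Proof.
have z'E : central_val z' = 1 - central_val z by rewrite -zz' addrC addKr.
have zz0 : central_val z * central_val z' = 0 by rewrite z'E mulrBr mulr1 central_idemP subrr.
have z'z0 : central_val z' * central_val z = 0 by rewrite -central_comm.
exists (fun p => val p.1 + val p.2).
  by move=> x; rewrite /= -mulrDl zz' mul1r.
move=> [u v]; have /eqP zu := valP u; have /eqP zv := valP v.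
congr pair; apply/val_inj; rewrite /= mulrDr.
  by rewrite zu -zv mulrA zz0 mul0r addr0.
by rewrite zv -zu mulrA z'z0 mul0r add0r.
Qed.

End Peirce.

Lemma irreducible_central (R : pzRingType) (z : R) : irreducible_ring R ->
  z * z = z -> (forall x, z * x = x * z) -> z = 0 \/ z = 1.
Proof.
move=> [_ nprod] zz zc.
have [->|z0] := eqVneq z 0; first by left.
have [->|z1] := eqVneq z 1; first by right.
have z'0 : 1 - z != 0 by rewrite subr_eq0 eq_sym.
have zz' : (1 - z) * (1 - z) = 1 - z.
  by rewrite mulrBr mulr1 mulrBl mul1r zz subrr subr0.
have zc' x : (1 - z) * x = x * (1 - z) by rewrite mulrBl mulrBr mul1r mulr1 zc.
exfalso; apply: nprod.
pose c := CentralIdem zz zc z0; pose c' := CentralIdem zz' zc' z'0.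
exists (corner c), (corner c'), (peirce c c' : {rmorphism R -> _}).
by apply: peirce_bij; rewrite /= addrC subrK.
Qed.

(** * Comparison of idempotents *)

Section PartialIso.
Variable R : pzRingType.
Hypothesis Rcont : continuous_ring R.
Implicit Types a b e f g k x y : R.

Let reg : regular_ring R. Proof. by case: Rcont. Qed.
Let cmpl : complete_lattice (principal_right_ideals R).
Proof. by case: Rcont. Qed.
Let mcont : chain_meet_continuous (principal_right_ideals R).
Proof. by case: Rcont. Qed.

(** If [xRy = 0], the join [eR] of the right ideals generated by the [r * y] is a two-sided ideal
    killed by [x]. Since [(1 - e)Re = 0], an element [c] of [eR(1 - e)] satisfies [c * b * c = 0]
    for all [b]; regularity gives [c = 0], so [e] is central and [y = 0] or [x = 0]. *)
Lemma irreducible_prime x y : irreducible_ring R ->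
  x <> 0 -> y <> 0 -> exists r, x * r * y <> 0.
Proof.
move=> Rirr x0 y0; apply: contrapT => /forallNP nr.
have xry r : x * r * y = 0 by apply: contrapT; apply: nr.
have [e [ee ef eub]] := join_exists reg cmpl (fun p : R * R => p.1 * y * p.2).
have e1 r : (1 - e) * r * e = 0.
  apply: eub => -[r1 s] /=.
  by have /= := ef (r * r1, s); rewrite !ncE => ->; rewrite subrr.
have e2 r : e * r * (1 - e) = 0.
  have [b] := reg (e * r * (1 - e)); rewrite !mulrA -(mulrA _ (1 - e)).
  by rewrite -(mulrA _ _ e) e1 !(mulr0, mul0r).
have ec r : e * r = r * e.
  move: (e1 r) (e2 r); rewrite !ncE => /eqP; rewrite subr_eq0 => /eqP ->.
  by move=> /eqP; rewrite subr_eq0 => /eqP.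
case: (irreducible_central Rirr ee ec) => E.
  by apply: y0; have := ef (1, 1); rewrite E /= mul0r mul1r mulr1.
apply: x0; rewrite -(mulr1 x) -E; apply: eub => -[r s] /=.
by rewrite !mulrA xry mul0r.
Qed.

(* Left multiplication by [a] maps [kR], inside [eR], isomorphically onto a
   right ideal inside [fR] that is independent of [kR]. *)
Definition partial_iso e f k a :=
  [/\ k * k = k, e * k = k, f * (a * k) = a * k, independent k (a * k)
    & forall y, a * k * y = 0 -> k * y = 0].

(** Zorn's lemma, with partial isomorphisms ordered by restriction: a chain is bounded by the join
    of its domains with the glued map. Maximality is stated for right ideals, as the preorder does
    not distinguish idempotents generating the same one. *)
Lemma maximal_partial_iso e f :
  exists k a, partial_iso e f k a /\
    forall k' a', partial_iso e f k' a' -> k' * k = k -> a' * k = a * k ->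
      k * k' = k'.
Proof.
pose T := {p : R * R | partial_iso e f p.1 p.2}.
pose le (s t : T) :=
  `[< (sval t).1 * (sval s).1 = (sval s).1 /\
      (sval t).2 * (sval s).1 = (sval s).2 * (sval s).1 >].
have T0 : T.
  exists (0, 0); split; rewrite /= ?mulr0 //.
  by move=> x [y ->]; rewrite mul0r.
have [||A Atot|[[k a] /= kaP] kamax] := @ZL_preorder T T0 le.
- by move=> t; apply/asboolP; case: (svalP t) => kk _ _ _ _.
- move=> r s t /asboolP[H1 H2] /asboolP[H3 H4]; apply/asboolP; split.
    by rewrite -H1 mulrA H3.
  by rewrite -H1 mulrA H4 -mulrA H1.
- pose I := {t : T | A t}.
  pose k (i : I) := (sval (sval i)).1; pose a (i : I) := (sval (sval i)).2.
  have kaP i : partial_iso e f (k i) (a i) := svalP (sval i).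
  have ch i j : (k j * k i = k i /\ a j * k i = a i * k i)
            \/ (k i * k j = k j /\ a i * k j = a j * k j).
    by case: (Atot _ _ (svalP i) (svalP j)) => /asboolP; [left|right].
  have dj i : independent (k i) (a i * k i) by case: (kaP i).
  have [b bk] := glue reg cmpl mcont ch dj.
  have [m jm] := join_exists reg cmpl k.
  have [h jh] := join_exists reg cmpl (fun i => a i * k i).
  have [mm mk mub] := jm; have [hh hr _] := jh.
  have chk : chain k.
    move=> i j; case: (kaP i) (kaP j) => ki _ _ _ _ [kj _ _ _ _].
    by case: (ch i j) => -[H _]; [left|right]; apply/ridlP.
  have mP : partial_iso e f m b.
    split=> //.
    - apply/eqP; rewrite eq_sym -subr_eq0 -{1}(mul1r m) -mulrBl; apply/eqP/mub.
      by move=> i; case: (kaP i) => _ ek _ _ _; rewrite mulrBl mul1r ek subrr.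
    - apply/eqP; rewrite eq_sym -subr_eq0 -{1}(mul1r (b * m)) -mulrBl mulrA.
      apply/eqP/mub => i; case: (kaP i) => _ _ fa _ _.
      by rewrite -mulrA bk mulrBl mul1r fa subrr.
    - have : independent m h.
        apply: (joins_independent reg cmpl mcont jm jh) => // i j.
        case: (ch i j) => -[H1 H2]; [left|right]; split.
        + by exists (k i).
        + by exists (k i); rewrite -mulrA H1.
        + by exists (k j).
        + by exists (k j); rewrite -mulrA H1.
      apply: independentS; first exact: ridl_self.
      apply/(ridlP _ hh)/eqP; rewrite eq_sym -subr_eq0 -{1}(mul1r (b * m)).
      rewrite -mulrBl mulrA; apply/eqP/mub => i.
      by rewrite -mulrA bk mulrBl mul1r hr subrr.
    (* Injectivity passes to the join by meet continuity: the annihilator [gR] of [b] meets each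
       [k i R] in zero. *)
    - move=> y bmy; have [g [_ bg Hg]] := annihilator_ridl reg b.
      have : independent m g.
        apply: (join_independent reg cmpl mcont jm chk) => i x [u ->] [v uv].
        case: (kaP i) => _ _ _ _; apply.
        by rewrite -bk -mulrA uv mulrA bg mul0r.
      by apply; [exists y|apply: Hg; rewrite mulrA].
  exists (exist _ (m, b) mP) => s As; apply/asboolP => /=.
  by split; [apply: (mk (exist _ s As))|apply: (bk (exist _ s As))].
exists k, a; split=> // k' a' P' H1 H2.
have /asboolP[] // : le (exist _ (k', a') P') (exist _ (k, a) kaP).
by apply: kamax; apply/asboolP.
Qed.

End PartialIso.

Section Subequivalence.
Variable R : pzRingType.
Implicit Types a b e f g k x y : R.

(* [eR] embeds into [fR], respectively [eR] and [fR] are isomorphic, as right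
   modules. *)
Definition subeqv e f := exists s t,
  [/\ f * s = s, s * e = s, e * t = t, t * f = t & t * s = e].

Definition eqv e f := exists s t,
  [/\ f * s = s, s * e = s, e * t = t, t * f = t & t * s = e /\ s * t = f].

Lemma eqv_sym e f : eqv e f -> eqv f e.
Proof. by move=> [s [t [? ? ? ? []]]]; exists t, s. Qed.

(** The step that contradicts maximality: a new piece [b] on [jR] is added to [a]. Here [p]
    generates the same right ideal as [k] but is orthogonal to [j], so that [p + j] is
    idempotent. *)
Lemma partial_iso_extend e f k p a b j x :
  partial_iso e f k a -> p * p = p -> p * k = k -> k * p = p ->
  j * j = j -> p * j = 0 -> j * p = 0 -> e * j = j -> f * b = b -> b * j = b ->
  x * b = j -> independent (p + j) (a * p + b) -> independent (a * p) b ->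
  [/\ partial_iso e f (p + j) (a * p + b), (p + j) * k = k
    & (a * p + b) * k = a * k].
Proof.
move=> [kk ek fa _ kinj] pp pk kp jj pj jp ej fb bj xb ind1 ind2.
have ep : e * p = p by rewrite -kp mulrA ek.
have fap : f * (a * p) = a * p by rewrite -kp !mulrA -(mulrA f) fa.
have jk : j * k = 0 by rewrite -pk mulrA jp mul0r.
have bp : b * p = 0 by rewrite -bj -mulrA jp mulr0.
have bk : b * k = 0 by rewrite -bj -mulrA jk mulr0.
have E : (a * p + b) * (p + j) = a * p + b.
  by rewrite !ncE (mulE pp) (mulE pj) bp bj mulr0 addr0 add0r.
split; last 2 first.
- by rewrite mulrDl pk jk addr0.
- by rewrite mulrDl -mulrA pk bk addr0.
split.
- by rewrite !ncE pp pj jp jj addr0 add0r.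
- by rewrite mulrDr ep ej.
- by rewrite E mulrDr fap fb.
- by rewrite E.
move=> y; rewrite E mulrDl => H.
have apy : a * p * y = 0.
  apply: ind2; first by exists y.
  by exists (- y); apply/eqP; rewrite mulrN -addr_eq0 H.
move: H; rewrite apy add0r => b_y.
have : a * k * (p * y) = 0 by rewrite mulrA -(mulrA a) kp.
by move=> /kinj; rewrite mulrA kp mulrDl => ->; rewrite add0r -xb -mulrA b_y mulr0.
Qed.

End Subequivalence.

(** * Comparison by rank, and halving *)

Section RankedRing.
Variables (K : realType) (R : pzRingType) (rk : R -> K).
Hypotheses (Rirr : irreducible_ring R) (Rcont : continuous_ring R).
Hypothesis rkP : rank_function rk.
Implicit Types a b e f g k x y : R.

Let reg : regular_ring R. Proof. by case: Rcont. Qed.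
Let cmpl : complete_lattice (principal_right_ideals R).
Proof. by case: Rcont. Qed.

Lemma rk_ge0 a : 0 <= rk a. Proof. by have [/(_ a)/andP[]] := rkP. Qed.

Lemma rk_mull a b : rk (a * b) <= rk a.
Proof. by have [_ _ /(_ a b)] := rkP; rewrite le_min => /andP[]. Qed.

Lemma rk_mulr a b : rk (a * b) <= rk b.
Proof. by have [_ _ /(_ a b)] := rkP; rewrite le_min => /andP[]. Qed.

Lemma rk_add e f : e * e = e -> f * f = f -> e * f = 0 -> f * e = 0 ->
  rk (e + f) = rk e + rk f.
Proof. by have [_ _ _ H _] := rkP; move=> ee ff ef fe; apply: (H e f). Qed.

Lemma rk_eq0 a : rk a = 0 -> a = 0.
Proof.
move=> ra; have [_ _ _ _ H] := rkP; apply: contrapT => /H.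
by rewrite ra ltxx.
Qed.

Lemma rk_gt0 a : a <> 0 -> 0 < rk a.
Proof. by have [_ _ _ _] := rkP; apply. Qed.

Lemma idem_sub e f : e * e = e -> f * f = f -> e * f = f -> f * e = f ->
  [/\ (e - f) * (e - f) = e - f, f * (e - f) = 0 & (e - f) * f = 0].
Proof.
move=> ee ff ef fe; split; rewrite !ncE ?ee ?ff ?ef ?fe; ncring.
Qed.

Lemma rk_sub e f : e * e = e -> f * f = f -> e * f = f -> f * e = f ->
  rk (e - f) = rk e - rk f.
Proof.
move=> ee ff ef fe; have [E1 E2 E3] := idem_sub ee ff ef fe.
by have := rk_add ff E1 E2 E3; rewrite addrC subrK => ->; rewrite addrAC subrr add0r.
Qed.

Lemma subeqv_rk e f : subeqv e f -> rk e <= rk f.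
Proof.
move=> [s [t [fs _ _ _ ts]]]; rewrite -ts (le_trans (rk_mulr _ _)) //.
by rewrite -fs rk_mull.
Qed.

Lemma eqv_rk e f : eqv e f -> rk e = rk f.
Proof.
move=> H; apply/eqP; rewrite eq_le; apply/andP; split; apply: subeqv_rk.
  by case: H => [s [t [? ? ? ? []]]]; exists s, t.
by case: (eqv_sym H) => [s [t [? ? ? ? []]]]; exists s, t.
Qed.

(** The image [s * t] of the embedding is a subidempotent of [f] of rank at least [rk e], so
    [f - s * t] has rank zero. *)
Lemma subeqv_eqv e f : e * e = e -> f * f = f -> subeqv e f -> rk f <= rk e ->
  eqv e f.
Proof.
move=> ee ff [s [t [fs se et tf ts]]] rfe; exists s, t; split=> //; split=> //.
have st2 : s * t * (s * t) = s * t by rewrite mulrA -(mulrA s) ts se.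
have : rk (f - s * t) = 0.
  have est : rk e <= rk (s * t).
    have -> : e = t * (s * t) * s by rewrite !mulrA ts -mulrA ts ee.
    by rewrite (le_trans (rk_mull _ _)) // rk_mulr.
  apply/eqP; rewrite eq_le rk_ge0 andbT rk_sub ?mulrA ?fs -1?mulrA ?tf //.
  by rewrite subr_le0 (le_trans rfe).
by move=> /rk_eq0/eqP; rewrite subr_eq0 => /eqP.
Qed.

(** A maximal partial isomorphism from [eR] to [fR] exhausts one of the two sides: otherwise
    primeness yields a non-zero element from the rest of [eR] to the rest of [fR], which restricts
    to a further piece. *)
Lemma compare_independent e f : e * e = e -> f * f = f -> independent e f ->
  subeqv e f \/ subeqv f e.
Proof.
move=> ee ff ief.
have [k [a [kaP kamax]]] := maximal_partial_iso Rcont e f.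
have [kk ek fak _ kinj] := kaP.
have [l [ll lak lin]] := ridl_idem reg (a * k).
have fl : f * l = l by case: lin => c ->; rewrite mulrA fak.
pose e1 := e - k * e; pose f1 := f - l * f.
have [e10|/eqP e10] := eqVneq e1 0.
  have ke : k * e = e by apply/eqP; rewrite eq_sym -subr_eq0; apply/eqP.
  left; have [b bP] := reg (a * e).
  have fae : f * (a * e) = a * e by rewrite -{1 2}ke !mulrA -(mulrA f) fak.
  exists (a * e), (e * b * f); split=> //.
  - by rewrite -mulrA ee.
  - by rewrite !mulrA ee.
  - by rewrite -mulrA ff.
  rewrite -(mulrA _ f) fae.
  have : a * k * (e * (b * (a * e) - e)) = 0.
    rewrite !mulrA -(mulrA a k e) ke; rewrite mulrBr !mulrA in bP *.
    by rewrite bP -mulrA ee subrr.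
  move=> /kinj; rewrite mulrA ke mulrBr ee !mulrA => /eqP.
  by rewrite subr_eq0 => /eqP.
have [f10|/eqP f10] := eqVneq f1 0.
  have lf : l * f = f by apply/eqP; rewrite eq_sym -subr_eq0; apply/eqP.
  right; case: lin => c lc.
  exists (k * c * f), (f * a * k * e); split.
  - by rewrite !mulrA ek.
  - by rewrite -mulrA ff.
  - by rewrite !mulrA ff.
  - by rewrite -mulrA ee.
  by rewrite !mulrA !(mulE ek) !(mulE kk) -!(mulrA f) -lc lf ff.
have [r b0] := irreducible_prime Rcont Rirr f10 e10.
pose b := f1 * r * e1; rewrite -/b in b0; have [x0 bxb] := reg b.
have e1e1 : e1 * e1 = e1 by rewrite /e1 !ncE !(mulE ek, mulE kk, mulE ee); ncring.
have f1f1 : f1 * f1 = f1 by rewrite /f1 !ncE !(mulE fl, mulE ll, mulE ff); ncring.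
have ke1 : k * e1 = 0 by rewrite /e1 mulrBr mulrA kk subrr.
have e1k : e1 * k = 0 by rewrite /e1 mulrBl -mulrA ek kk subrr.
have lf1 : l * f1 = 0 by rewrite /f1 mulrBr mulrA ll subrr.
have ee1 : e * e1 = e1 by rewrite /e1 mulrBr mulrA ek ee.
have ff1 : f * f1 = f1 by rewrite /f1 mulrBr mulrA fl ff.
have f1b : f1 * b = b by rewrite /b !mulrA f1f1.
have be1 : b * e1 = b by rewrite /b -mulrA e1e1.
clearbody b.
pose x := e1 * x0 * f1; pose j := x * b.
have bj : b * j = b by rewrite /j /x !mulrA be1 (mulE f1b) bxb.
have jj : j * j = j by rewrite {1}/j -mulrA bj.
have e1j : e1 * j = j by rewrite /j /x !mulrA e1e1.
have je1 : j * e1 = j by rewrite /j -mulrA be1.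
have kj : k * j = 0 by rewrite -e1j mulrA ke1 mul0r.
have jk : j * k = 0 by rewrite -je1 -mulrA e1k mulr0.
have ej : e * j = j by rewrite -e1j mulrA ee1.
have fb : f * b = b by rewrite -f1b mulrA ff1.
have [||P1 P2 P3] := partial_iso_extend kaP kk kk kk jj kj jk ej fb bj erefl.
- apply: independentS ief; apply/ridlP => //; first by rewrite mulrDr ek ej.
  by rewrite mulrDr fak fb.
- move=> y [u yu] [v yv]; have : l * y = 0.
    by rewrite yv -f1b !mulrA lf1 !mul0r.
  by rewrite yu mulrA lak.
have := kamax _ _ P1 P2 P3; rewrite mulrDr kk kj => /addrI j0.
by exfalso; apply: b0; rewrite -bj -j0 mulr0.
Qed.

(** The embedding of the complements is completed by the identity on the common part [gR]. *)
Lemma subeqv_extend g e f : g * g = g -> e * g = g -> f * g = g ->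
  subeqv (e - g * e) (f - g * f) -> e * e = e -> f * f = f -> subeqv e f.
Proof.
move=> gg eg fg [s [t [fs se et tf ts]]] ee ff.
have gs : g * s = 0 by rewrite -fs mulrA mulrBr mulrA gg subrr mul0r.
have tg : t * g = 0.
  by rewrite -tf -mulrA mulrBl -mulrA fg gg subrr mulr0.
have fs' : f * s = s.
  by move: fs; rewrite mulrBl => <-; rewrite mulrBr !mulrA fg ff.
have et' : e * t = t.
  by move: et; rewrite mulrBl => <-; rewrite mulrBr !mulrA eg ee.
have tf' : t * f = t by move: tf; rewrite mulrBr mulrA tg mul0r subr0.
have sg : s * g = 0.
  by rewrite -se -mulrA mulrBl -mulrA eg gg subrr mulr0.
have se' : s * e = s by move: se; rewrite mulrBr mulrA sg mul0r subr0.
exists (g * e + s), (g * f + t); split.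
- by rewrite mulrDr mulrA fg fs'.
- by rewrite mulrDl -mulrA ee se'.
- by rewrite mulrDr mulrA eg et'.
- by rewrite mulrDl -mulrA ff tf'.
rewrite !ncE !(mulE fg) !(mulE gg) (mulE tg) (mulE fs') gs ts mul0r.
ncring.
Qed.

(** Removing the intersection of [eR] and [fR] leaves independent complements. If these compare the
    wrong way round, [fR] embeds into [eR], and [rk e <= rk f] turns the embedding into an
    isomorphism. *)
Lemma rk_compare e f : e * e = e -> f * f = f -> rk e <= rk f -> subeqv e f.
Proof.
move=> ee ff ref.
have [g gg gP] := meet_exists reg cmpl e f.
have [/(ridlP _ ee) eg /(ridlP _ ff) fg] := (gP g).1 (ridl_self g).
have idem x : x * x = x -> x * g = g -> (x - g * x) * (x - g * x) = x - g * x.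
  by move=> xx xg; rewrite !ncE !(mulE xg, mulE gg, mulE xx); ncring.
have ind : independent (e - g * e) (f - g * f).
  move=> x /(ridlP _ (idem _ ee eg)) ex /(ridlP _ (idem _ ff fg)) fx.
  have : ridl g x.
    apply/gP; split; apply/ridlP => //.
      by rewrite -ex !ncE ee eg.
    by rewrite -fx !ncE ff fg.
  move=> /(ridlP _ gg) gx; rewrite -ex -gx mulrA mulrBl -(mulrA g) eg gg.
  by rewrite subrr mul0r.
case: (compare_independent (idem _ ee eg) (idem _ ff fg) ind) => H.
  exact: (subeqv_extend gg eg fg H).
have fe : subeqv f e by apply: (subeqv_extend gg fg eg H).
have [s [t [? ? ? ? []]]] := eqv_sym (subeqv_eqv ff ee fe ref).
by move=> *; exists s, t.
Qed.

Lemma rk_eqv e f : e * e = e -> f * f = f -> rk e = rk f -> eqv e f.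
Proof.
by move=> ee ff r; apply: subeqv_eqv; rewrite ?r //; apply: rk_compare; rewrite ?r.
Qed.

Hypothesis Rnd : ~ discrete_ring rk.

Lemma rk_small (c : K) : 0 < c -> exists2 x, x <> 0 & rk x < c.
Proof.
move=> c0; apply: contrapT => H; apply: Rnd => U x Ux.
exists c => // y /= xy; suff -> : y = x by [].
apply/eqP; rewrite eq_sym -subr_eq0; apply/eqP; apply: contrapT => n0.
by apply: H; exists (x - y).
Qed.

(** There are no minimal idempotents: primeness moves an element of rank below [rk e] into [eR]
    without making it zero, and it generates a right ideal strictly smaller than [eR]. *)
Lemma proper_subidem e : e * e = e -> e <> 0 ->
  exists h, [/\ h * h = h, e * h = h, h * e = h, h <> 0 & h <> e].
Proof.
move=> ee e0; have [x x0 rx] := rk_small (rk_gt0 e0).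
have [r a0] := irreducible_prime Rcont Rirr e0 x0.
set a := e * r * x in a0; have [b aba] := reg a.
have ea : e * a = a by rewrite /a !mulrA ee.
have ra : rk a < rk e by apply: le_lt_trans rx; apply: rk_mulr.
clearbody a.
exists (a * b * e); split.
- by rewrite !mulrA -(mulrA _ e) ea aba.
- by rewrite !mulrA ea.
- by rewrite -mulrA ee.
- by move=> h0; apply: a0; rewrite -aba -{2}ea mulrA h0 mul0r.
move=> he; move: ra; rewrite -he ltNge => /negP; apply.
by rewrite -mulrA rk_mull.
Qed.

(** A maximal partial isomorphism of [eR] into itself, with range independent of its domain, must
    fill [eR]: a non-zero rest [r] would contain a proper [h], and primeness would give a non-zero
    map from [hR] to [(r - h)R] to extend by. *)
Lemma halving e : e * e = e ->
  exists p q, [/\ p * p = p, q * q = q, p * q = 0, q * p = 0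
    & p + q = e /\ eqv p q].
Proof.
move=> ee; have [k [a [kaP kamax]]] := maximal_partial_iso Rcont e e.
have [kk ek eak ind kinj] := kaP.
have [p [q [pp qq pq qp [kp akq [ep pe] [eq_ qe]]]]] :=
  independent_idem_split reg ee kk ek eak ind.
have pk : p * k = k by apply/(ridlP _ pp); rewrite -kp; apply: ridl_self.
have k_p : k * p = p by apply/(ridlP _ kk); rewrite kp; apply: ridl_self.
have qak : q * (a * k) = a * k.
  by apply/(ridlP _ qq); rewrite -akq; apply: ridl_self.
have qap : q * (a * p) = a * p by rewrite -k_p !mulrA -(mulrA q) qak.
pose r := e - p - q.
have [r0|/eqP r0] := eqVneq r 0.
  exists p, q; split=> //; split.
    by apply/eqP; rewrite eq_sym -subr_eq0 opprD addrA; apply/eqP.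
  have [c qc] : ridl (a * k) q by rewrite akq; apply: ridl_self.
  have [t [pt tq st]] : exists t, [/\ p * t = t, t * q = t & a * p * t = q].
    exists (p * k * c * q); split; rewrite ?mulrA ?pp //.
      by rewrite -mulrA qq.
    by rewrite -(mulrA a) pp -(mulrA a) pk -qc qq.
  exists (a * p), t; split=> //; first by rewrite -mulrA pp.
  split=> //; have : a * k * (p * (t * (a * p) - p)) = 0.
    rewrite mulrA -(mulrA a k p) k_p mulrBr mulrA st qap.
    by rewrite -mulrA pp subrr.
  by move=> /kinj; rewrite mulrA k_p mulrBr pp mulrA pt => /eqP;
    rewrite subr_eq0 => /eqP.
have rr : r * r = r.
  rewrite /r !ncE ee ep eq_ pe qe pp qq pq qp; ncring.
have [h [hh rh hr h0 hner]] := proper_subidem rr r0.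
have d0 : r - h <> 0 by move=> /eqP; rewrite subr_eq0 => /eqP E; apply: hner.
have [z b0] := irreducible_prime Rcont Rirr d0 h0.
pose b := (r - h) * z * h; rewrite -/b in b0; have [x0 bxb] := reg b.
have [dd hd dh] := idem_sub rr hh rh hr.
have rp : r * p = 0 by rewrite /r !ncE ep pp qp; ncring.
have pr : p * r = 0 by rewrite /r !ncE pe pp pq; ncring.
have qr : q * r = 0 by rewrite /r !ncE qe qp qq; ncring.
have er : e * r = r by rewrite /r !ncE ee ep eq_.
have ph : p * h = 0 by rewrite -rh mulrA pr mul0r.
have qh : q * h = 0 by rewrite -rh mulrA qr mul0r.
have hp : h * p = 0 by rewrite -hr -mulrA rp mulr0.
have rq : r * q = 0 by rewrite /r !ncE eq_ pq qq; ncring.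
have hq : h * q = 0 by rewrite -hr -mulrA rq mulr0.
have db : (r - h) * b = b by rewrite /b !mulrA dd.
have bh : b * h = b by rewrite /b -mulrA hh.
clearbody b.
pose x := h * x0 * (r - h); pose j := x * b.
have bj : b * j = b by rewrite /j /x !mulrA bh (mulE db) bxb.
have jj : j * j = j by rewrite {1}/j -mulrA bj.
have hj : h * j = j by rewrite /j /x !mulrA hh.
have jh : j * h = j by rewrite /j -mulrA bh.
have xb : x * b = j by [].
clearbody j.
have pj : p * j = 0 by rewrite -hj mulrA ph mul0r.
have jp : j * p = 0 by rewrite -jh -mulrA hp mulr0.
have ej : e * j = j by rewrite -hj -rh !mulrA er.
have eb : e * b = b by rewrite -db mulrA mulrBr er -{1}rh mulrA er rh.
have pb : p * b = 0 by rewrite -db mulrA mulrBr pr ph subrr mul0r.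
have qb : q * b = 0 by rewrite -db mulrA mulrBr qr qh subrr mul0r.
have hb : h * b = 0 by rewrite -db mulrA hd mul0r.
have [||P1 P2 P3] := partial_iso_extend kaP pp pk k_p jj pj jp ej eb bj xb.
- move=> y [u yu] [v yv].
  have py : p * y = 0.
    by rewrite yv mulrA mulrDr -qap mulrA pq mul0r pb addr0 mul0r.
  have hy : h * y = 0.
    by rewrite yv mulrA mulrDr -qap mulrA hq mul0r hb addr0 mul0r.
  have : (p + h) * y = y.
    have E : (p + h) * (p + j) = p + j.
      by rewrite !ncE pp pj hp hj addr0 add0r.
    by rewrite yu mulrA E.
  by rewrite mulrDl py hy addr0.
- move=> y [u yu] [v yv]; have : q * y = 0 by rewrite yv mulrA qb mul0r.
  by rewrite yu mulrA qap.
have := kamax _ _ P1 P2 P3; rewrite mulrDr k_p => /addrI kj.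
have : p * j = j by rewrite -kj mulrA pk.
by rewrite pj => j0; exfalso; apply: b0; rewrite -bj -j0 mulr0.
Qed.

End RankedRing.

(** * Units of corner rings *)

Section CornerUnits.
Variable R : pzRingType.
Implicit Types a b c e f g h k p u v w x y z : R.

(** The inverse [v] is carried along because [pRp] is not made into a ring of its own. *)
Definition cunit p u v :=
  [/\ p * u = u, u * p = u, p * v = v, v * p = v & u * v = p /\ v * u = p].

Definition hat p u := u + (1 - p).

Lemma cunit_sym p u v : cunit p u v -> cunit p v u.
Proof. by move=> [? ? ? ? []]. Qed.

Lemma cunit_idem p u v : cunit p u v -> p * p = p.
Proof. by move=> [pu _ _ _ [uv _]]; rewrite -{2}uv mulrA pu. Qed.

Lemma cunitM p u v u' v' : cunit p u v -> cunit p u' v' ->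
  cunit p (u * u') (v' * v).
Proof.
move=> [pu up pv vp [uv vu]] [pu' up' pv' vp' [uv' vu']].
split; rewrite -?(mulrA _ _ p) ?up' ?vp // ?mulrA ?pu ?pv' //.
by split; [rewrite -(mulrA u) uv' up uv|rewrite -(mulrA v') vu vp' vu'].
Qed.

Lemma cunitD p q u v u' v' : p * q = 0 -> q * p = 0 ->
  cunit p u v -> cunit q u' v' -> cunit (p + q) (u + u') (v + v').
Proof.
move=> pq qp [pu up pv vp [uv vu]] [pu' up' pv' vp' [uv' vu']].
have z1 x y : p * x = x -> y * q = y -> y * x = 0.
  by move=> <- <-; rewrite mulrA -(mulrA y) qp mulr0 mul0r.
have z2 x y : x * p = x -> q * y = y -> x * y = 0.
  by move=> <- <-; rewrite mulrA -(mulrA x) pq mulr0 mul0r.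
have qq := cunit_idem (And5 pu' up' pv' vp' (conj uv' vu')).
have pp := cunit_idem (And5 pu up pv vp (conj uv vu)).
by split; [..|split]; rewrite !ncE ?(z1 u q) ?(z1 v q) ?(z2 p u') ?(z2 p v')
  ?(z2 u q) ?(z2 v q) ?(z1 p u') ?(z1 p v') ?(z2 u v') ?(z1 v u') ?(z2 v u')
  ?(z1 u v') ?pu ?up ?pv ?vp ?uv ?vu ?pu' ?up' ?pv' ?vp' ?uv' ?vu' ?addr0 ?add0r.
Qed.

Lemma cunit_transport p q s t u v : q * s = s -> s * p = s -> p * t = t ->
  t * q = t -> t * s = p -> s * t = q ->
  cunit p u v -> cunit q (s * u * t) (s * v * t).
Proof.
move=> qs sp pt tq ts st [pu up pv vp [uv vu]].
split; rewrite ?mulrA ?qs -?(mulrA _ t q) ?tq //; split.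
  by rewrite -(mulrA _ t) ts -(mulrA _ u) up -(mulrA s) uv sp st.
by rewrite -(mulrA _ t) ts -(mulrA _ v) vp -(mulrA s) vu sp st.
Qed.

Lemma cunit1 p : p * p = p -> cunit p p p.
Proof. by []. Qed.

Lemma cunit_elementary p a : p * p = p -> p * a = a -> a * p = a -> a * a = 0 ->
  cunit p (p + a) (p - a).
Proof.
move=> pp pa ap aa.
by split; [..|split]; rewrite !ncE ?pp ?pa ?ap ?aa; ncring.
Qed.

Lemma hatM p u v : p * p = p -> p * v = v -> u * p = u ->
  hat p (u * v) = hat p u * hat p v.
Proof. by move=> pp pv up; rewrite /hat !ncE pv up pp; ncring. Qed.

Lemma hat1 p : hat p p = 1.
Proof. by rewrite /hat addrC subrK. Qed.

End CornerUnits.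

Section HatUnit.
Variable R : unitRingType.
Implicit Types p u v : R.

Lemma hat_inv p u v : cunit p u v ->
  hat p u \is a GRing.unit /\ (hat p u)^-1 = hat p v.
Proof.
move=> cu; have [pu up pv vp [uv vu]] := cu.
have pp := cunit_idem cu.
have H1 : hat p u * hat p v = 1 by rewrite -hatM // uv hat1.
have H2 : hat p v * hat p u = 1 by rewrite -hatM // vu hat1.
have U : hat p u \is a GRing.unit by apply/unitrP; exists (hat p v).
by split=> //; rewrite -[LHS]mulr1 -H1 mulKr.
Qed.

End HatUnit.

(** * Stable range one and factorisation of 2x2 block units *)

Section GL2.
Variables (K : realType) (R : pzRingType) (rk : R -> K).
Hypotheses (Rirr : irreducible_ring R) (Rcont : continuous_ring R).
Hypothesis rkP : rank_function rk.
Implicit Types a b c e f g h k p t u v w x y z : R.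

Let reg : regular_ring R. Proof. by case: Rcont. Qed.

(** Direct finiteness of [hRh]: [x * y] is a subidempotent of [h] whose rank is at least that of
    [h = y * (x * y) * x]. *)
Lemma corner_left_inv h x y : h * h = h -> h * x = x -> x * h = x ->
  h * y = y -> y * h = y -> y * x = h -> x * y = h.
Proof.
move=> hh hx xh hy yh yx.
have xyi : x * y * (x * y) = x * y by rewrite mulrA -(mulrA x) yx xh.
have : rk (h - x * y) = 0.
  apply/eqP; rewrite eq_le (rk_ge0 rkP) andbT.
  rewrite (rk_sub rkP) // ?mulrA ?hx // -?mulrA ?yh // subr_le0.
  have -> : rk h = rk (y * (x * y) * x).
    by rewrite !mulrA yx hy yx.
  by rewrite (le_trans (rk_mull rkP _ _)) // rk_mulr.
by move=> /(rk_eq0 rkP)/eqP; rewrite subr_eq0 => /eqP.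
Qed.

(* Stable range one for the corner [hRh]: the first column [(A, C)] of an
   invertible 2x2 matrix becomes a unit [A + t C] for some [t]. *)
Lemma stable_range_one h h' A C P Q :
  h * h = h -> h' * h' = h' -> h * A = A -> A * h = A -> h' * C = C ->
  C * h = C -> h * P = P -> P * h = P -> h * Q = Q -> Q * h' = Q ->
  P * A + Q * C = h ->
  exists t x', [/\ h * t = t, t * h' = t, h * x' = x', x' * h = x'
    & x' * (A + t * C) = h /\ (A + t * C) * x' = h].
Proof.
move=> hh hh' hA Ah hC Ch hP Ph hQ Qh PAQC.
have [b [hb bh AbA bAb]] :
    exists b, [/\ h * b = b, b * h = b, A * b * A = A & b * A * b = b].
  have [b AbA] := reg A; exists (h * b * A * b * h); split.
  - by rewrite !mulrA hh.
  - by rewrite -mulrA hh.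
  - by rewrite !mulrA Ah AbA -(mulrA _ h) hA AbA.
  have AbA' z : z * A * b * A = z * A by rewrite -!mulrA (mulrA A) AbA.
  by rewrite !mulrA !(mulE hA, mulE Ah) !AbA'.
have bAi : b * A * (b * A) = b * A by rewrite mulrA bAb.
have Abi : A * b * (A * b) = A * b by rewrite mulrA AbA.
(* Projections onto the kernel of [A] and onto a complement of its image. Having equal rank they are
   isomorphic, and [phi] fills the cokernel from the kernel. *)
pose k := h - b * A; pose r := h - A * b.
have hbA : h * (b * A) = b * A by rewrite mulrA hb.
have bAh : b * A * h = b * A by rewrite -mulrA Ah.
have hAb : h * (A * b) = A * b by rewrite mulrA hA.
have Abh : A * b * h = A * b by rewrite -mulrA bh.
have [kk _ _] := idem_sub hh bAi hbA bAh; rewrite -/k in kk.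
have [rr _ _] := idem_sub hh Abi hAb Abh; rewrite -/r in rr.
have rkr : rk k = rk r.
  rewrite !(rk_sub rkP) //; congr (_ - _).
  apply/eqP; rewrite eq_le; apply/andP; split.
    rewrite (le_trans (rk_mulr rkP _ _)) // -{1}AbA; exact: rk_mull.
  rewrite (le_trans (rk_mull rkP _ _)) // -{1}AbA -mulrA; exact: rk_mulr.
have [phi [psi [rphi phik kpsi psir [psiphi _]]]] :=
  rk_eqv Rirr Rcont rkP kk rr rkr.
have hr : h * r = r by rewrite /r mulrBr hh hAb.
have rh : r * h = r by rewrite /r mulrBl hh Abh.
have hk : h * k = k by rewrite /k mulrBr hh hbA.
have rA : r * A = 0 by rewrite /r mulrBl hA AbA subrr.
have Ak : A * k = 0 by rewrite /k mulrBr Ah mulrA AbA subrr.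
have br : b * r = 0 by rewrite /r mulrBr bh mulrA bAb subrr.
have bphi : b * phi = 0 by rewrite -rphi mulrA br mul0r.
have psiA : psi * A = 0 by rewrite -psir -mulrA rA mulr0.
have hphi : h * phi = phi by rewrite -rphi mulrA hr.
have hpsi : h * psi = psi by rewrite -kpsi mulrA hk.
have psih : psi * h = psi by rewrite -psir -mulrA rh.
have QC : Q * C = h - P * A by rewrite -PAQC addrC addKr.
have kE : k = h - b * A by [].
clearbody k r.
(* On the kernel of [A] the relation [P * A + Q * C = h] makes [Q * C] the identity, so [t * C] is
   [phi] there. The error [N] of the left inverse [b + psi] has square zero because [A * k = 0]. *)
pose t := phi * Q; pose x := A + t * C; pose N := k * P * A.
have ht : h * t = t by rewrite /t mulrA hphi.
have NN : N * N = 0 by rewrite /N !mulrA -(mulrA _ A) Ak mulr0 !mul0r.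
have kh : k * h = k by rewrite kE mulrBl hh bAh.
have hN : h * N = N by rewrite /N !mulrA hk.
have Nh : N * h = N by rewrite /N -mulrA Ah.
have bx : (b + psi) * x = h - N.
  rewrite /x /t !ncE bphi psiA mul0r psiphi -(mulrA k) QC mulrBr kh /N {1}kE.
  by rewrite !mulrA; ncring.
clearbody N.
pose x' := (h + N) * (b + psi).
have x'x : x' * x = h.
  by rewrite /x' -mulrA bx !ncE hh hN Nh NN; ncring.
have hx' : h * x' = x' by rewrite /x' mulrA (mulrDr h) hh hN.
have x'h : x' * h = x' by rewrite /x' -mulrA (mulrDl b) bh psih.
exists t, x'; split=> //; first by rewrite /t -mulrA Qh.
split=> //; apply: corner_left_inv => //.
  by rewrite mulrDr mulrA ht hA.
by rewrite mulrDl -mulrA Ch Ah.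
Qed.

(** Stable range one makes the upper left block of [(g + t) * v] invertible for some [t] in [hRh'];
    block elimination with that pivot gives the other factors. *)
Lemma GL2_decomposition g h h' v w : h * h = h -> h' * h' = h' ->
  h * h' = 0 -> h' * h = 0 -> h + h' = g -> cunit g v w ->
  exists a b c x x' y y',
    [/\ h * a = a /\ a * h' = a, h' * b = b /\ b * h = b,
        h * c = c /\ c * h' = c, cunit h x x' /\ cunit h' y y'
      & v = (g + a) * (g + b) * (g + c) * (x + y)].
Proof.
move=> hh hh' hk kh gE [gv vg gw wg [vw wv]].
have gh : g * h = h by rewrite -gE mulrDl hh kh addr0.
have hg : h * g = h by rewrite -gE mulrDr hh hk addr0.
have gh' : g * h' = h' by rewrite -gE mulrDl hh' hk add0r.
have h'g : h' * g = h' by rewrite -gE mulrDr hh' kh add0r.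
have gg : g * g = g by rewrite -{2}vw mulrA gv.
pose A := h * v * h; pose C := h' * v * h.
pose P := h * w * h; pose Q := h * w * h'.
have hA : h * A = A by rewrite /A !mulrA hh.
have Ah : A * h = A by rewrite /A -mulrA hh.
have hC : h' * C = C by rewrite /C !mulrA hh'.
have Ch : C * h = C by rewrite /C -mulrA hh.
have hP : h * P = P by rewrite /P !mulrA hh.
have Ph : P * h = P by rewrite /P -mulrA hh.
have hQ : h * Q = Q by rewrite /Q !mulrA hh.
have Qh : Q * h' = Q by rewrite /Q -mulrA hh'.
have PAQC : P * A + Q * C = h.
  have : h * w * g * v * h = h by rewrite -(mulrA h) wg -(mulrA h) wv hg hh.
  by rewrite -gE /P /A /Q /C !ncE !(mulE hh, mulE hh').
have [t [x' [ht th' hx' x'h [x'x xx']]]] :=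
  stable_range_one hh hh' hA Ah hC Ch hP Ph hQ Qh PAQC.
have gt : g * t = t by rewrite -ht mulrA gh.
have tg : t * g = t by rewrite -th' -mulrA h'g.
have th : t * h = 0 by rewrite -th' -mulrA kh mulr0.
have h't : h' * t = 0 by rewrite -ht mulrA kh mul0r.
have tt : t * t = 0 by rewrite -{1}th' -mulrA h't mulr0.
pose M := (g + t) * v; pose W := w * (g - t).
have gM : g * M = M by rewrite /M mulrA mulrDr gg gt.
have Mg : M * g = M by rewrite /M -mulrA vg.
have gW : g * W = W by rewrite /W mulrA gw.
have Wg : W * g = W by rewrite /W -mulrA mulrBl gg tg.
have MW : M * W = g.
  rewrite /M /W !mulrA -(mulrA _ v) vw mulrDl gg tg !ncE gg gt tg tt; ncring.
have WM : W * M = g.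
  have E : (g - t) * (g + t) = g by rewrite !ncE gg gt tg tt; ncring.
  by rewrite /M /W !mulrA -(mulrA w) E wg wv.
have vE : v = (g - t) * M.
  have E : (g - t) * (g + t) = g by rewrite !ncE gg gt tg tt; ncring.
  by rewrite /M mulrA E gv.
pose X := A + t * C.
have hMh : h * M * h = X by rewrite /X /M /A /C !ncE hg ht th'.
have hX : h * X = X by rewrite -hMh !mulrA hh.
have Xh : X * h = X by rewrite -hMh -mulrA hh.
rewrite -/X in x'x xx'; clearbody X M W.
pose m := h * M * h'; pose n := h' * M * h; pose d := h' * M * h'.
pose q := h * W * h'; pose r := h' * W * h; pose s := h' * W * h'.
have hm : h * m = m by rewrite /m !mulrA hh.
have mh' : m * h' = m by rewrite /m -mulrA hh'.
have hn : h' * n = n by rewrite /n !mulrA hh'.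
have nh : n * h = n by rewrite /n -mulrA hh.
have hd : h' * d = d by rewrite /d !mulrA hh'.
have dh : d * h' = d by rewrite /d -mulrA hh'.
have hq : h * q = q by rewrite /q !mulrA hh.
have rh : r * h = r by rewrite /r -mulrA hh.
have hs : h' * s = s by rewrite /s !mulrA hh'.
have sh : s * h' = s by rewrite /s -mulrA hh'.
have E1 : X * q + m * s = 0.
  have : h * (M * g * W) * h' = 0 by rewrite Mg MW hg hk.
  by rewrite -hMh /m /q /s -gE !ncE !(mulE hh, mulE hh').
have E2 : n * q + d * s = h'.
  have : h' * (M * g * W) * h' = h' by rewrite Mg MW h'g hh'.
  by rewrite /n /d /q /s -gE !ncE !(mulE hh, mulE hh').
have E3 : r * X + s * n = 0.
  have : h' * (W * g * M) * h = 0 by rewrite Wg WM h'g kh.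
  by rewrite -hMh /n /r /s -gE !ncE !(mulE hh, mulE hh').
have E4 : r * m + s * d = h'.
  have : h' * (W * g * M) * h' = h' by rewrite Wg WM h'g hh'.
  by rewrite /m /d /r /s -gE !ncE !(mulE hh, mulE hh').
have ME : M = X + m + n + d.
  rewrite -hMh /m /n /d -{1}gM -{1}Mg -gE !ncE; ncring.
clearbody m n d q r s.
have qE : q = - (x' * m * s).
  by apply/eqP; rewrite -addr_eq0 -hq -x'x -!mulrA -mulrDr E1 mulr0.
have rE : r = - (s * n * x').
  by apply/eqP; rewrite -addr_eq0 -rh -xx' !mulrA -mulrDl E3 mul0r.
(* The Schur complement of the pivot [X]; its inverse is the lower right block [s] of [W], the
   inverse of [M]. *)
pose y := d - n * x' * m.
have ys : y * s = h'.
  by rewrite -E2 qE /y !ncE; ncring.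
have sy : s * y = h'.
  by rewrite -E4 rE /y !ncE; ncring.
have hy : h' * y = y by rewrite /y mulrBr !mulrA hd hn.
have yh : y * h' = y by rewrite /y mulrBl -(mulrA _ m) mh' dh.
have yE : d = y + n * x' * m by rewrite /y subrK.
clearbody y.
exists (- t), (n * x'), (m * s), X, x', y, s; split=> //.
- by rewrite mulrN mulNr ht th'.
- by rewrite mulrA hn -mulrA x'h.
- by rewrite mulrA hm -mulrA sh.
rewrite vE -!(mulrA (g - t)); congr (_ * _); rewrite -mulrA.
have gX : g * X = X by rewrite -hX mulrA gh.
have gm : g * m = m by rewrite -hm mulrA gh.
have gy : g * y = y by rewrite -hy mulrA gh'.
have sX : s * X = 0 by rewrite -sh -hX mulrA -(mulrA s) kh mulr0 mul0r.
have -> : (g + m * s) * (X + y) = X + y + m.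
  rewrite !ncE gX gy -(mulrA m s X) sX -(mulrA m s y) sy mh'; ncring.
have x'y : x' * y = 0 by rewrite -x'h -hy mulrA -(mulrA x') hk mulr0 mul0r.
rewrite ME yE !ncE gX gy gm (mulE x'x) nh (mulE x'y); ncring.
Qed.

End GL2.

(** * Infinite block sums *)

Section Blocks.
Variables (K : realType) (R : pzRingType) (rk : R -> K).
Hypotheses (Rirr : irreducible_ring R) (Rcont : continuous_ring R).
Hypotheses (rkP : rank_function rk) (Rnd : ~ discrete_ring rk).
Implicit Types a e f h p t u v w x y z : R.

Let reg : regular_ring R. Proof. by case: Rcont. Qed.
Let cmpl : complete_lattice (principal_right_ideals R).
Proof. by case: Rcont. Qed.
Let mcont : chain_meet_continuous (principal_right_ideals R).
Proof. by case: Rcont. Qed.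

Lemma rk_compl e : e * e = e -> rk (1 - e) = 1 - rk e.
Proof.
move=> ee; rewrite (rk_sub rkP) ?mulr1 ?mul1r //.
by case: rkP => _ ->.
Qed.

Lemma halving_function : exists P : R -> R, forall e, e * e = e ->
  [/\ P e * P e = P e, e * P e = P e, P e * e = P e, eqv (P e) (e - P e)
    & rk (P e) = rk e / 2].
Proof.
suff /boolp.choice[P PP] : forall e, exists p, e * e = e ->
    [/\ p * p = p, e * p = p, p * e = p, eqv p (e - p) & rk p = rk e / 2].
  by exists P.
move=> e.
have [ee|] := pselect (e * e = e); last by exists 0.
have [p [q [pp qq pq qp [<- pqv]]]] := halving Rirr Rcont rkP Rnd ee.
exists p => _; split=> //.
- by rewrite mulrDl pp qp addr0.
- by rewrite mulrDr pp pq addr0.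
- by rewrite addrC addKr.
by rewrite (rk_add rkP) // -(eqv_rk rkP pqv); field.
Qed.

(** The last clause makes [E] the join of the [g i]; by it an element of [RE] is determined by its
    columns [x * g i]. *)
Definition blocks (E : R) (g : nat -> R) :=
  [/\ E * E = E, forall i, g i * g i = g i,
      forall i j, i <> j -> g i * g j = 0,
      forall i, E * g i = g i /\ g i * E = g i
    & forall a, (forall i, a * g i = 0) -> a * E = 0].

Lemma geometric_blocks (F : R) : F * F = F ->
  exists (E : R) (g : nat -> R), [/\ blocks E g, F * E = E, E * F = E
                & forall i, rk (g i) = rk F / 2 ^+ i.+1].
Proof.
move=> FF; have [P PP] := halving_function.
pose r n := iter n P F.
have rr n : r n * r n = r n.
  by elim: n => [//|n IH]; have [] := PP _ IH.
have rS n m : (n <= m)%N -> r n * r m = r m /\ r m * r n = r m.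
  elim: m => [|m IH]; first by rewrite leqn0 => /eqP ->; rewrite rr.
  rewrite leq_eqVlt => /orP[/eqP ->|]; first by rewrite rr.
  rewrite ltnS => /IH[H1 H2]; have [_ H3 H4 _ _] := PP _ (rr m).
  rewrite /= -/(r m) in H3 H4 *; split.
    by rewrite -{1}H3 mulrA H1 H3.
  by rewrite -{1}H4 -mulrA H2 H4.
have rkr n : rk (r n) = rk F / 2 ^+ n.
  elim: n => [|n IH]; first by rewrite expr0 divr1.
  by have [_ _ _ _ ->] := PP _ (rr n); rewrite IH exprS; field.
pose g n := r n - r n.+1.
have gg n : g n * g n = g n.
  by have [H1 H2] := rS _ _ (leqnSn n); have [] := idem_sub (rr n) (rr n.+1) H1 H2.
have rg n m : (n <= m)%N -> r n * g m = g m /\ g m * r n = g m.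
  move=> nm; have [H1 H2] := rS _ _ nm; have [H3 H4] := rS _ _ (leqW nm).
  by rewrite /g mulrBl mulrBr H1 H2 H3 H4.
have gr n m : (n < m)%N -> r m * g n = 0 /\ g n * r m = 0.
  move=> nm; have [H1 H2] := rS _ _ nm; have [H3 H4] := rS _ _ (ltnW nm).
  by rewrite /g mulrBl mulrBr H1 H2 H3 H4 subrr.
have go i j : i <> j -> g i * g j = 0.
  move=> /eqP; rewrite neq_ltn => /orP[] ij.
    by have [<- _] := rg _ _ ij; have [_ H] := gr _ _ (ltnSn i); rewrite mulrA H mul0r.
  by have [_ <-] := rg _ _ ij; have [H _] := gr _ _ (ltnSn j); rewrite -mulrA H mulr0.
have Fg i : F * g i = g i /\ g i * F = g i by apply: (rg 0%N).
have [e [ee eg eub]] := join_exists reg cmpl g.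
have Fe : F * e = e.
  apply/eqP; rewrite eq_sym -subr_eq0 -{1}(mul1r e) -mulrBl; apply/eqP/eub => i.
  by rewrite mulrBl mul1r (Fg i).1 subrr.
have ge i : g i * (e * F) = (g i * e) * F by rewrite mulrA.
(* The join [e] is only known to be a left identity for the [g i]. Multiplying by [e * F] on the
   right makes the relations with [E] and [F] two-sided and keeps the ranks. *)
exists (e * F), (fun i => g i * (e * F)); split.
- split.
  + by rewrite mulrA -(mulrA e) Fe ee.
  + by move=> i; rewrite !mulrA -(mulrA _ F) (Fg i).1 -(mulrA (g i) e) eg gg.
  + move=> i j ij.
    by rewrite !mulrA -(mulrA _ F) (Fg j).1 -(mulrA (g i) e) eg go // !mul0r.
  + move=> i; split.
      by rewrite !mulrA -(mulrA e F) (Fg i).1 eg.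
    by rewrite !mulrA -(mulrA _ F) Fe -(mulrA _ e e) ee.
  + move=> a H; suff : a * e = 0 by rewrite mulrA => ->; rewrite mul0r.
    apply: eub => i; have := congr1 (fun x => x * g i) (H i).
    by rewrite mul0r !mulrA -!mulrA (Fg i).1 eg gg.
- by rewrite mulrA Fe.
- by rewrite -mulrA FF.
move=> i; transitivity (rk (g i)).
  apply/eqP; rewrite eq_le (rk_mull rkP) /=.
  have {1}-> : g i = g i * (e * F) * g i by rewrite -!mulrA (Fg i).1 eg gg.
  exact: rk_mull.
have [H1 H2] := rS _ _ (leqnSn i).
by rewrite /g (rk_sub rkP) // !rkr exprS; field.
Qed.

Section BlockSum.
Variables (E : R) (g : nat -> R).
Hypotheses (Eg : blocks E g) (rkE : rk E <= 1 / 2).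

Lemma block_ext x y : x * E = x -> y * E = y ->
  (forall i, x * g i = y * g i) -> x = y.
Proof.
move=> xE yE H; have [_ _ _ _ sep] := Eg; apply/eqP; rewrite -subr_eq0.
rewrite -xE -yE -mulrBl; apply/eqP/sep => i.
by rewrite mulrBl H subrr.
Qed.

Lemma block_sum_exists (b : nat -> R) :
  (forall i, E * b i = b i /\ b i * g i = b i) ->
  exists a, [/\ E * a = a, a * E = a & forall i, a * g i = b i].
Proof.
move=> bP; have [EE gg go EgE sep] := Eg.
have E'E' : (1 - E) * (1 - E) = 1 - E by rewrite !ncE EE; ncring.
have [|s [t [s1 s2 t1 t2 ts]]] := rk_compare Rirr Rcont rkP EE E'E'.
  by rewrite rk_compl //; move: rkE; lra.
(* The chain to glue is [s * S n] on [k n]: [s] moves the values under [1 - E], away from the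
   domains, and [t] brings the glued map back. *)
pose k n := \sum_(i < n) g i; pose S n := \sum_(i < n) b i.
have kE n : E * k n = k n.
  by rewrite /k mulr_sumr; apply: eq_bigr => i _; case: (EgE i).
have SE n : E * S n = S n.
  by rewrite /S mulr_sumr; apply: eq_bigr => i _; case: (bP i).
have bg i j : i <> j -> b i * g j = 0.
  by move=> ij; rewrite -(bP i).2 -mulrA go // mulr0.
have kg n i : (i < n)%N -> k n * g i = g i.
  move=> ni; rewrite /k mulr_suml (bigD1 (Ordinal ni)) //= gg big1 ?addr0 //.
  by move=> j /eqP nj; apply: go => ji; apply: nj; apply: val_inj.
have Sg n i : (i < n)%N -> S n * g i = b i.
  move=> ni; rewrite /S mulr_suml (bigD1 (Ordinal ni)) //= (bP i).2 big1 ?addr0 //.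
  by move=> j /eqP nj; apply: bg => ji; apply: nj; apply: val_inj.
have kk n m : (m <= n)%N -> k n * k m = k m.
  move=> mn; rewrite {2 3}/k mulr_sumr; apply: eq_bigr => i _.
  by rewrite kg // (leq_trans _ mn).
have Sk n m : (m <= n)%N -> S n * k m = S m.
  move=> mn; rewrite /k mulr_sumr {2}/S; apply: eq_bigr => i _.
  by rewrite Sg // (leq_trans _ mn).
have [||c cP] := glue reg cmpl mcont (k := k) (a := fun n => s * S n).
- move=> i j; case: (leqP i j) => [ij|/ltnW ij]; [left|right];
    by rewrite kk // -!mulrA !Sk.
- move=> n x [y xy] [z xz]; have Ex : E * x = x by rewrite xy mulrA kE.
  have : E * x = 0.
    rewrite xz -!mulrA mulrA; suff -> : E * s = 0 by rewrite mul0r.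
    by rewrite -s1 mulrA mulrBr mulr1 EE subrr mul0r.
  by rewrite Ex.
exists (t * c * E); split.
- by rewrite !mulrA t1.
- by rewrite -mulrA EE.
have ck n : c * k n = s * S n by rewrite cP -mulrA Sk.
move=> i; rewrite -mulrA (EgE i).1 -(kg i.+1 i) // mulrA -(mulrA t) ck.
rewrite -!mulrA Sg // mulrA ts.
by case: (bP i).
Qed.
End BlockSum.
End Blocks.

(** * Length functions on the unit group *)

Section BlockOperator.
Variables (R : pzRingType) (E : R) (g : nat -> R) (bd : (nat -> R) -> R).
Hypothesis Eg : blocks E g.
Hypothesis bdP : forall b : nat -> R,
  (forall i, E * b i = b i /\ b i * g i = b i) ->
  [/\ E * bd b = bd b, bd b * E = bd b & forall i, bd b * g i = b i].
Implicit Types b c u v : nat -> R.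

(** Diagonal families, with [b i] in the [i]-th corner. [bd] also accepts columns that leave their
    corner, as shifts of the blocks do. *)
Definition block_family b := forall i, g i * b i = b i /\ b i * g i = b i.

Lemma block_family_sub b : block_family b ->
  forall i, E * b i = b i /\ b i * g i = b i.
Proof.
have [_ _ _ EgE _] := Eg.
by move=> H i; have [H1 H2] := H i; split=> //; rewrite -H1 mulrA (EgE i).1.
Qed.

Lemma block_family_g : block_family g.
Proof. by have [_ gg _ _ _] := Eg => i; split; apply: gg. Qed.

Lemma bd_block b i x : block_family b -> g i * x = x -> bd b * x = b i * x.
Proof.
move=> bb gx; have [_ _ H] := bdP (block_family_sub bb).
by rewrite -gx mulrA H mulrA (bb i).2.
Qed.

Lemma bd_corner b : block_family b -> E * bd b = bd b /\ bd b * E = bd b.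
Proof. by move=> /block_family_sub/bdP[]. Qed.

Lemma bdE b i : block_family b -> bd b * g i = b i.
Proof. by move=> /block_family_sub/bdP[]. Qed.

Lemma bd_mul b c : block_family b -> block_family c ->
  block_family (fun i => b i * c i) /\ bd b * bd c = bd (fun i => b i * c i).
Proof.
move=> bb cb.
have bcb : block_family (fun i => b i * c i).
  by move=> i; rewrite mulrA (bb i).1 -mulrA (cb i).2.
split=> //; apply: (block_ext Eg).
- by rewrite -mulrA (bd_corner cb).2.
- by rewrite (bd_corner bcb).2.
move=> i; rewrite -mulrA (bdE _ cb) (bdE _ bcb) (@bd_block _ i) //.
exact: (cb i).1.
Qed.

Lemma bd_add b c : block_family b -> block_family c ->
  block_family (fun i => b i + c i) /\ bd b + bd c = bd (fun i => b i + c i).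
Proof.
move=> bb cb.
have bcb : block_family (fun i => b i + c i).
  by move=> i; rewrite mulrDr mulrDl (bb i).1 (bb i).2 (cb i).1 (cb i).2.
split=> //; apply: (block_ext Eg).
- by rewrite mulrDl (bd_corner bb).2 (bd_corner cb).2.
- by rewrite (bd_corner bcb).2.
by move=> i; rewrite mulrDl !bdE.
Qed.

Lemma bd_ext b x : block_family b -> x * E = x ->
  (forall i, x * g i = b i) -> x = bd b.
Proof.
move=> bb xE xg; apply: (block_ext Eg) => //; first by rewrite (bd_corner bb).2.
by move=> i; rewrite xg bdE.
Qed.

Lemma bd_g : bd g = E.
Proof.
have [EE _ _ EgE _] := Eg; apply/esym/bd_ext => //; first exact: block_family_g.
by move=> i; rewrite (EgE i).1.
Qed.

Lemma bd_cunit u v : (forall i, cunit (g i) (u i) (v i)) ->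
  [/\ block_family u, block_family v & cunit E (bd u) (bd v)].
Proof.
move=> H.
have ub : block_family u by move=> i; case: (H i).
have vb : block_family v by move=> i; case: (H i).
have [Eu uE] := bd_corner ub; have [Ev vE] := bd_corner vb.
split=> //; split=> //; have [EE _ _ EgE _] := Eg; split.
  have [_ ->] := bd_mul ub vb; rewrite -bd_g; congr bd; apply/funext => i.
  by case: (H i) => _ _ _ _ [].
have [_ ->] := bd_mul vb ub; rewrite -bd_g; congr bd; apply/funext => i.
by case: (H i) => _ _ _ _ [].
Qed.

End BlockOperator.

Section LengthFunction.
Variables (K : realType) (R : unitRingType) (rk : R -> K).
Hypotheses (Rirr : irreducible_ring R) (Rcont : continuous_ring R).
Hypotheses (rkP : rank_function rk) (Rnd : ~ discrete_ring rk).
Variable L : R -> K.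
Hypothesis L_mul : forall x y, x \is a GRing.unit -> y \is a GRing.unit ->
  L (x * y) <= L x + L y.
Hypothesis L_inv : forall x, x \is a GRing.unit -> L x^-1 = L x.
Implicit Types a f p u v w x y z : R.

Definition bounded_on p :=
  exists N, forall u v, cunit p u v -> L (hat p u) <= N.

(** The constant may depend on [z] but not on [u], so every use fixes [z] before the unit that
    varies. *)
Definition commutators_bounded f := forall z z', cunit f z z' ->
  exists C, forall u v, cunit f u v -> L (hat f (u * z * v * z')) <= C.

Lemma L_hatM f u v x y : cunit f u v -> cunit f x y ->
  L (hat f (u * x)) <= L (hat f u) + L (hat f x).
Proof.
move=> cu cx; have [_ uf _ _ _] := cu; have [fx _ _ _ _] := cx.
rewrite hatM // ?(cunit_idem cu) //; apply: L_mul.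
  by have [] := hat_inv cu.
by have [] := hat_inv cx.
Qed.

Lemma block_operator (E : R) (g : nat -> R) : blocks E g -> rk E <= 1 / 2 ->
  exists bd : (nat -> R) -> R, forall b : nat -> R,
  (forall i, E * b i = b i /\ b i * g i = b i) ->
  [/\ E * bd b = bd b, bd b * E = bd b & forall i, bd b * g i = b i].
Proof.
move=> Eg rE.
suff /boolp.choice[bd bdP] : forall b : nat -> R, exists a,
  (forall i, E * b i = b i /\ b i * g i = b i) ->
  [/\ E * a = a, a * E = a & forall i, a * g i = b i] by exists bd.
move=> b; have [H|] := pselect (forall i, E * b i = b i /\ b i * g i = b i).
  by have [a aP] := block_sum_exists Rirr Rcont rkP Eg rE H; exists a.
by exists 0.
Qed.

(* Diagonal argument: if for each [n] some unit [u n] of the [n]-th corner had no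
   extension of length at most [n], the block sum of the [u n] would have no
   finite length. *)
Lemma full_block (E : R) (g : nat -> R) : blocks E g -> rk E <= 1 / 2 ->
  exists n N, forall u v, cunit (g n) u v ->
  exists w, [/\ w \is a GRing.unit, L w <= N, w * g n = u & g n * w = u].
Proof.
move=> Eg rE; have [bd bdP] := block_operator Eg rE.
apply: contrapT => /forallNP nfull.
have /boolp.choice[uv uvP] : forall n, exists p : R * R, cunit (g n) p.1 p.2 /\
    forall w, w \is a GRing.unit -> w * g n = p.1 -> g n * w = p.1 -> n%:R < L w.
  move=> n; apply: contrapT => /forallNP H; apply: (nfull n).
  exists n%:R => u v cu; apply: contrapT => /forallNP Hw; apply: (H (u, v)).
  split=> //= w Uw w1 w2; rewrite ltNge; apply/negP => Lw.
  by apply: (Hw w).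
have [ub _ cu] := bd_cunit Eg bdP (fun n => (uvP n).1).
set u := bd _ in cu ub; have [Uu _] := hat_inv cu.
have [EE gg go EgE sep] := Eg.
(* The block sum extends the bad unit of every corner; the contradiction arises at an index beyond
   its length. *)
pose n := (Num.truncn (L (hat E u))).+1.
have [[gu1 ug _ _ _] /(_ (hat E u) Uu)] := uvP n.
have un : u * g n = (uv n).1 by rewrite /u (bdE Eg bdP _ ub).
have gu : g n * u = (uv n).1.
  apply: (block_ext Eg); first by rewrite -mulrA (bd_corner Eg bdP ub).2.
    by rewrite -ug -mulrA (EgE n).2.
  move=> i; rewrite -mulrA (bdE Eg bdP _ ub).
  have [gui _] := ub i; rewrite -gui mulrA.
  have [->|/eqP ni] := eqVneq i n; first by rewrite gg gu1 ug.
  rewrite go ?mul0r; last by move=> E'; apply: ni.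
  by rewrite -ug -mulrA go ?mulr0 // => E'; apply: ni.
have g1 : g n * (1 - E) = 0 by rewrite mulrBr mulr1 (EgE n).2 subrr.
have g2 : (1 - E) * g n = 0 by rewrite mulrBl mul1r (EgE n).1 subrr.
rewrite /hat mulrDl mulrDr g1 g2 !addr0 => /(_ un gu).
rewrite ltNge => /negP; apply; apply/ltW; exact: truncnS_gt.
Qed.

(** The extension [w] of [u] respects the splitting by [f], so conjugating [hat f z] by [w] gives
    [hat f (u * z * v)], whatever [w] does on [1 - f]. *)
Lemma full_commutator f N : (forall u v, cunit f u v ->
    exists w, [/\ w \is a GRing.unit, L w <= N, w * f = u & f * w = u]) ->
  commutators_bounded f.
Proof.
move=> full z z' cz; have [Uz z'E] := hat_inv cz.
exists (N + L (hat f z) + N + L (hat f z)) => u v cu.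
have [w [Uw Lw wf fw]] := full _ _ cu.
have ff := cunit_idem cu.
have [fu uf fv vf [uv vu]] := cu; have [fz zf fz' z'f [zz' z'z]] := cz.
have E : hat f (u * z * v) * w = w * hat f z.
  have -> : hat f (u * z * v) * w = u * z * v * (f * w) + w - f * w.
    by rewrite /hat !ncE (mulE vf); ncring.
  have wz : w * z = u * z by rewrite -{1}fz mulrA wf.
  rewrite fw -(mulrA (u * z)) vu -mulrA zf /hat !ncE wf wz; ncring.
have -> : hat f (u * z * v * z') = w * hat f z * w^-1 * (hat f z)^-1.
  rewrite z'E hatM //; last by rewrite (mulE vf).
  congr (_ * _).
  by rewrite -E mulrK.
have Uw' : w^-1 \is a GRing.unit by rewrite unitrV.
have Uz' : (hat f z)^-1 \is a GRing.unit by rewrite unitrV.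
have Uwz : w * hat f z \is a GRing.unit by rewrite unitrMl.
have Uwzw : w * hat f z * w^-1 \is a GRing.unit by rewrite unitrMl.
apply: (le_trans (L_mul Uwzw Uz')); rewrite (L_inv Uz) lerD2r.
apply: (le_trans (L_mul Uwz Uw')); rewrite (L_inv Uw) lerD //.
by apply: (le_trans (L_mul Uw Uz)); rewrite lerD2r.
Qed.

(** The idempotent [Z] gives room to factor [a = b * s] with [b] in [hRZ] and [s] in [ZRh']; the
    commutator of [f + b] and [f + s] is [f + a]. Since [s] is fixed, the bound does not depend on
    [a]. *)
Lemma commutator_elementary f h h' Z s t : commutators_bounded f ->
  f * f = f -> f * h = h -> Z * f = Z ->  f * Z = Z -> h' * f = h' ->
  Z * h = 0 -> h' * Z = 0 -> h' * h = 0 ->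
  Z * s = s -> s * h' = s -> h' * t = t -> t * Z = t -> t * s = h' ->
  exists C, forall a, h * a = a -> a * h' = a -> L (hat f (f + a)) <= C.
Proof.
move=> cb ff fh Zf fZ h'f Zh h'Z h'h Zs sh' h't tZ ts.
have fs : f * s = s by rewrite -Zs mulrA fZ.
have sf : s * f = s by rewrite -sh' -mulrA h'f.
have ss : s * s = 0 by rewrite -{1}sh' -{2}Zs -mulrA (mulrA h') h'Z mul0r mulr0.
have [C HC] := cb _ _ (cunit_elementary ff fs sf ss).
exists C => a ha ah'.
pose b := a * t.
have fb : f * b = b by rewrite /b -ha !mulrA fh.
have bf : b * f = b by rewrite /b -tZ -!mulrA Zf.
have bb : b * b = 0.
  by rewrite /b -{2}ha -tZ -!mulrA (mulrA Z) Zh mul0r !mulr0.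
have sb : s * b = 0 by rewrite /b -sh' -ha -!mulrA (mulrA h') h'h mul0r mulr0.
have bs : b * s = a by rewrite /b -mulrA ts.
have := HC _ _ (cunit_elementary ff fb bf bb).
suff -> : (f + b) * (f + s) * (f - b) * (f - s) = f + a by [].
clearbody b; rewrite !ncE !(mulE ff, mulE fb, mulE bf, mulE fs, mulE sf, mulE bb,
  mulE ss, mulE sb, mulE bs, mul0r, mulr0, add0r, addr0, subr0, sub0r).
have af : a * f = a by rewrite -ah' -mulrA h'f.
have ab : a * b = 0 by rewrite -bs -mulrA sb mulr0.
have a_s : a * s = 0 by rewrite -bs -mulrA ss mulr0.
have aa : a * a = 0 by rewrite -{1}ah' -{2}ha -mulrA (mulrA h') h'h mul0r mulr0.
rewrite !(af, ab, a_s, aa, mul0r, mulr0); ncring.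
Qed.

End LengthFunction.

(** * The sequence of units in the swindle *)

Section SwindleSequence.
Variables (K : realType) (R : pzRingType) (rk : R -> K).
Hypotheses (Rirr : irreducible_ring R) (Rcont : continuous_ring R).
Hypothesis rkP : rank_function rk.
Implicit Types a b c e f p q s t u v w x y z : R.

(** Matrix units that make [gRg] a ring of 2x2 matrices over [hRh]. *)
Definition half_pair (g h h' s t : R) :=
  [/\ [/\ h * h = h, h' * h' = h', h * h' = 0, h' * h = 0 & h + h' = g],
      h' * s = s, s * h = s, h * t = t & t * h' = t /\ (t * s = h /\ s * t = h')].

(** As 2x2 matrices over [hRh]: three elementary factors, then [diag (z^-1, z)], then [diag (d, 1)],
    the unit that lives on half of [g]. *)
Definition swindle_data (g h h' s t u : R) (D : R * R * R * (R * R) * (R * R)) :=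
  let: (a, b, c, (z, z'), (d, d')) := D in
  [/\ [/\ h * a = a, a * h' = a, h' * b = b & b * h = b],
      h * c = c /\ c * h' = c, cunit h z z', cunit h d d'
    & u = (g + a) * (g + b) * (g + c) * (z' + s * z * t) * (d + h')].

Lemma swindle_step (g h h' : R) s t u v : half_pair g h h' s t -> cunit g u v ->
  exists D, swindle_data g h h' s t u D.
Proof.
move=> [[hh hh' hk kh gE] h's sh ht [th' [ts st]]] cu.
have [a [b [c [x [x' [y [y' [[ha ah'] [hb bh] [hc ch'] [cx cy] uE]]]]]]]] :=
  GL2_decomposition Rirr Rcont rkP hh hh' hk kh gE cu.
have cz := cunit_transport ht th' h's sh st ts cy.
(* Let [z] be [y] moved to [hRh]; then [diag (x, y)] is [diag (z^-1, z)] times [diag (z * x, 1)]. *)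
exists (a, b, c, (t * y * s, t * y' * s), (t * y * s * x, x' * (t * y' * s))).
split=> //; first exact: cunitM.
have [hy yh _ _ _] := cy; have [hx xh _ _ _] := cx.
have -> : s * (t * y * s) * t = y.
  by rewrite !mulrA st hy -mulrA st yh.
rewrite uE -[RHS]mulrA; congr (_ * _).
have [_ _ _ z'h [_ z'z]] := cz; have [hz _ _ _ _] := cz.
set z := t * y * s in z'z hz *; set z' := t * y' * s in z'h z'z *.
clearbody z z'.
have E1 : z' * h' = 0 by rewrite -z'h -mulrA hk mulr0.
have E2 : y * z = 0 by rewrite -yh -hz -mulrA (mulrA h') kh mul0r mulr0.
rewrite !ncE z'z hx E1 E2 yh; ncring.
Qed.

Section Sequence.
Variables g h h' s t k l : nat -> R.
Hypothesis half : forall i, half_pair (g i) (h i) (h' i) (s i) (t i).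
Hypothesis kl : forall i, [/\ g i.+1 * k i = k i, k i * h i = k i,
  h i * l i = l i, l i * g i.+1 = l i & l i * k i = h i /\ k i * l i = g i.+1].

Lemma swindle_sequence u v : cunit (g 0%N) u v -> exists us vs : nat -> R,
  exists D : nat -> R * R * R * (R * R) * (R * R),
  [/\ us 0%N = u, vs 0%N = v, forall i, cunit (g i) (us i) (vs i),
      forall i, swindle_data (g i) (h i) (h' i) (s i) (t i) (us i) (D i)
    & forall i, us i.+1 = k i * (D i).2.1 * l i /\
                vs i.+1 = k i * (D i).2.2 * l i].
Proof.
move=> cu.
(* Choosing the data for all triples at once makes the sequence a plain recursion; the invariant
   [cuv] keeps it away from the default zeros. *)
have /boolp.choice[D DP] : forall q : nat * (R * R), exists D,
    cunit (g q.1) q.2.1 q.2.2 ->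
    swindle_data (g q.1) (h q.1) (h' q.1) (s q.1) (t q.1) q.2.1 D.
  move=> [i [x y]] /=.
  have [cxy|] := pselect (cunit (g i) x y); last by exists (0, 0, 0, (0, 0), (0, 0)).
  by have [D DP] := swindle_step (half i) cxy; exists D.
pose uv := fix uv n := if n is m.+1 then
  let d := (D (m, uv m)).2 in (k m * d.1 * l m, k m * d.2 * l m) else (u, v).
have cuv i : cunit (g i) (uv i).1 (uv i).2.
  elim: i => [//|i IH]; have := DP (i, uv i) IH.
  rewrite /swindle_data /=; case: (D (i, uv i)) => [[[[a b] c] [z z']] [d d']] /=.
  move=> [_ _ _ cd _]; have [gk kh hl lg [lk klE]] := kl i.
  exact: cunit_transport cd.
exists (fun i => (uv i).1), (fun i => (uv i).2), (fun i => D (i, uv i)).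
by split=> // i; apply: (DP (i, uv i)).
Qed.

End Sequence.
End SwindleSequence.

(** * Commutators of block sums *)

Section BlockCommutators.
Variables (K : realType) (R : unitRingType) (rk : R -> K).
Hypotheses (Rirr : irreducible_ring R) (Rcont : continuous_ring R).
Hypothesis rkP : rank_function rk.
Variable L : R -> K.
Implicit Types e f p q x y : R.

Section Operators.
Variables (f E : R) (g h h' s t k l : nat -> R) (bd : (nat -> R) -> R).
Hypothesis ff : f * f = f.
Hypothesis fE : f * E = E.
Hypothesis Ef : E * f = E.
Hypothesis Eg : blocks E g.
Hypothesis bdP : forall b : nat -> R,
  (forall i, E * b i = b i /\ b i * g i = b i) ->
  [/\ E * bd b = bd b, bd b * E = bd b & forall i, bd b * g i = b i].
Hypothesis half : forall i, half_pair (g i) (h i) (h' i) (s i) (t i).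
Hypothesis kl : forall i, [/\ g i.+1 * k i = k i, k i * h i = k i,
  h i * l i = l i, l i * g i.+1 = l i & l i * k i = h i /\ k i * l i = g i.+1].
Hypothesis fcb : commutators_bounded L f.

Let o := f - E.
(** The block sum is completed by the identity only up to [f], not up to 1, so that it gives units
    of [fRf]. *)
Definition blockf (b : nat -> R) := bd b + (f - E).
Let H := bd h.

Let EE : E * E = E. Proof. by case: Eg. Qed.

Let gh i : g i * h i = h i /\ h i * g i = h i.
Proof.
have [[hh _ hk kh <-] _ _ _ _] := half i.
by rewrite mulrDl mulrDr hh hk kh addr0.
Qed.

Let gh' i : g i * h' i = h' i /\ h' i * g i = h' i.
Proof.
have [[_ hh hk kh <-] _ _ _ _] := half i.
by rewrite mulrDl mulrDr hh hk kh add0r.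
Qed.

Let hB : block_family g h. Proof. exact: gh. Qed.

Lemma blockf_mul b c : block_family g b -> block_family g c ->
  blockf b * blockf c = blockf (fun i => b i * c i).
Proof.
move=> bb cb; rewrite /blockf.
have [_ <-] := bd_mul Eg bdP bb cb.
have [_ bE] := bd_corner Eg bdP bb; have [Ec _] := bd_corner Eg bdP cb.
have bf : bd b * f = bd b by rewrite -bE -mulrA Ef.
have fc : f * bd c = bd c by rewrite -Ec mulrA fE.
by rewrite !ncE bE bf Ec fc EE Ef fE ff; ncring.
Qed.

Lemma blockf_cunit u v : (forall i, cunit (g i) (u i) (v i)) ->
  cunit f (blockf u) (blockf v).
Proof.
move=> cuv; have [_ _ cE] := bd_cunit Eg bdP cuv.
have oo : o * o = o by have [] := idem_sub ff EE fE Ef.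
have Eo : E * o = 0 by rewrite /o mulrBr Ef EE subrr.
have oE : o * E = 0 by rewrite /o mulrBl fE EE subrr.
have := cunitD Eo oE cE (cunit1 oo).
by rewrite /blockf {1}/o addrC subrK.
Qed.

Lemma blockf_elementary a : block_family g a ->
  block_family g (fun i => g i + a i) /\ f + bd a = blockf (fun i => g i + a i).
Proof.
move=> ab; have [H1 H2] := bd_add Eg bdP (block_family_g Eg) ab.
by split=> //; rewrite /blockf -H2 (bd_g Eg bdP); ncring.
Qed.

Let hh i : h i * h i = h i. Proof. by case: (half i) => -[]. Qed.

Let bd_eq (b c : nat -> R) : (forall i, b i = c i) -> bd b = bd c.
Proof. by move=> bc; congr bd; apply/funext. Qed.

Let bdMl (p b : nat -> R) : block_family g p -> block_family g b ->
  (forall i, p i * b i = b i) -> bd p * bd b = bd b.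
Proof.
by move=> pB bB pb; have [_ ->] := bd_mul Eg bdP pB bB; apply: bd_eq.
Qed.

Let bdMr (b p : nat -> R) : block_family g p -> block_family g b ->
  (forall i, b i * p i = b i) -> bd b * bd p = bd b.
Proof.
by move=> pB bB pb; have [_ ->] := bd_mul Eg bdP bB pB; apply: bd_eq.
Qed.

Let HH : H * H = H. Proof. by rewrite /H bdMl. Qed.
Let EH : E * H = H /\ H * E = H. Proof. exact: (bd_corner Eg bdP hB). Qed.

(* The block [diag (z^-1, z)] is the commutator of [diag (z^-1, 1)] with the swap of
   [h i] and [h' i]. *)
Lemma swap_commutator_bound : exists C, forall z z' : nat -> R,
  (forall i, cunit (h i) (z i) (z' i)) ->
  (forall i, cunit (g i) (z' i + s i * z i * t i) (z i + s i * z' i * t i)) /\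
  L (hat f (blockf (fun i => z' i + s i * z i * t i))) <= C.
Proof.
pose w i := s i + t i.
have sw i : cunit (g i) (w i) (w i).
  have [[_ _ hk kh gE] h's sh ht [th' [ts st]]] := half i.
  have gs : g i * s i = s i by rewrite -h's mulrA (gh' i).1.
  have gt : g i * t i = t i by rewrite -ht mulrA (gh i).1.
  have sg : s i * g i = s i by rewrite -sh -mulrA (gh i).2.
  have tg : t i * g i = t i by rewrite -th' -mulrA (gh' i).2.
  have ss : s i * s i = 0 by rewrite -{1}sh -{2}h's -mulrA (mulrA (h i)) hk mul0r mulr0.
  have tt : t i * t i = 0 by rewrite -{1}th' -{2}ht -mulrA (mulrA (h' i)) kh mul0r mulr0.
  have ww : w i * w i = g i by rewrite /w !ncE ss tt ts st -gE add0r addr0 addrC.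
  by split; rewrite // /w ?mulrDl ?mulrDr ?gs ?gt ?sg ?tg.
have [C HC] := fcb (blockf_cunit sw).
exists C => z z' cz.
have cz' i : cunit (g i) (z' i + h' i) (z i + h' i).
  have [[_ hh' hk kh <-] _ _ _ _] := half i.
  by apply: cunitD => //; exact: cunit_sym (cz i).
have qE i : (z' i + h' i) * w i * (z i + h' i) * w i = z' i + s i * z i * t i.
  have [[_ _ hk kh gE] h's sh ht [th' [ts st]]] := half i.
  have [hz zh hz' z'h _] := cz i.
  have z's : z' i * s i = 0 by rewrite -z'h -h's -mulrA (mulrA (h i)) hk mul0r mulr0.
  have h't : h' i * t i = 0 by rewrite -ht mulrA kh mul0r.
  have sh' : s i * h' i = 0 by rewrite -sh -mulrA hk mulr0.
  have tz : t i * z i = 0 by rewrite -th' -hz -mulrA (mulrA (h' i)) kh mul0r mulr0.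
  have zs : z i * s i = 0 by rewrite -zh -h's -mulrA (mulrA (h i)) hk mul0r mulr0.
  have tt : t i * t i = 0 by rewrite -{1}th' -{2}ht -mulrA (mulrA (h' i)) kh mul0r mulr0.
  have ss : s i * s i = 0 by rewrite -{1}sh -{2}h's -mulrA (mulrA (h i)) hk mul0r mulr0.
  by rewrite /w !ncE !(mulE z's, mulE tt, mulE ss, mulE h's, mulE h't, mulE sh', mulE tz, mulE zs,
    mulE th', mulE ts, mulE z'h, mul0r, mulr0, add0r, addr0).
have qF : forall i, cunit (g i) (z' i + s i * z i * t i) (z i + s i * z' i * t i).
  move=> i; have [[_ _ hk kh <-] h's sh ht [th' [ts st]]] := half i.
  apply: cunitD => //; first exact: cunit_sym (cz i).
  exact: cunit_transport (cz i).
split=> //.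
have := HC _ _ (blockf_cunit cz').
have wB : block_family g w by move=> i; case: (sw i).
have zB : block_family g (fun i => z' i + h' i) by move=> i; case: (cz' i).
have z'B : block_family g (fun i => z i + h' i) by move=> i; case: (cz' i).
have [P1 _] := bd_mul Eg bdP zB wB; have [P2 _] := bd_mul Eg bdP P1 z'B.
rewrite !blockf_mul //; suff -> : (fun i => (z' i + h' i) * w i * (z i + h' i) * w i) = fun i => z' i + s i * z i * t i by [].
exact/funext.
Qed.

(* The second factor is a conjugate of the inverse of the first one, by a fixed
   unit of [fRf] that carries [h i] to [g i.+1] by means of [k i]. *)
Lemma shift_commutator_bound : exists C, forall d d' vs : nat -> R,
  (forall i, cunit (h i) (d i) (d' i)) ->
  (forall i, vs i.+1 = k i * d' i * l i) ->
  (forall i, cunit (g i) (d i + h' i) (d' i + h' i)) /\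
  L (hat f (blockf (fun i => d i + h' i) *
            blockf (fun i => if i is 0%N then g 0%N else vs i))) <= C.
Proof.
have [_ gg go EgE _] := Eg.
(* [l j] has its source in block [j.+1], hence the shift of index. Column 0 vanishes, as the image
   [E1] of [Kap] misses the block [g 0]. *)
pose l0 i := if i is j.+1 then l j else 0.
have kg i : k i * g i = k i.
  by have [_ kh _ _ _] := kl i; rewrite -kh -mulrA (gh i).2.
have gl i : g i * l i = l i.
  by have [_ _ hl _ _] := kl i; rewrite -hl mulrA (gh i).1.
have kP i : E * k i = k i /\ k i * g i = k i.
  by have [gk _ _ _ _] := kl i; rewrite kg -gk mulrA (EgE _).1.
have lP i : E * l0 i = l0 i /\ l0 i * g i = l0 i.
  case: i => [|i]; rewrite /l0 ?mulr0 ?mul0r //.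
  by have [_ _ _ lg _] := kl i; rewrite lg -gl mulrA (EgE _).1.
pose Kap := bd k; pose Lam := bd l0; pose E1 := E - g 0%N.
have [EK KE Kg] := bdP kP; have [EL LE Lg] := bdP lP.
rewrite -/Kap in EK KE Kg; rewrite -/Lam in EL LE Lg.
have EE1 : E * E1 = E1 by rewrite /E1 mulrBr EE (EgE 0%N).1.
have E1E : E1 * E = E1 by rewrite /E1 mulrBl EE (EgE 0%N).2.
have KapH : Kap * H = Kap.
  apply: (block_ext Eg) => //; first by rewrite -mulrA EH.2.
  move=> i; rewrite -mulrA (bdE Eg bdP _ hB) Kg.
  by rewrite -(gh i).1 mulrA Kg; case: (kl i).
have LK : Lam * Kap = H.
  apply: (block_ext Eg); [by rewrite -mulrA KE|exact: EH.2|move=> i].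
  rewrite -mulrA Kg (bdE Eg bdP _ hB); have [gk _ _ _ [lk _]] := kl i.
  by rewrite -gk mulrA Lg.
have KL : Kap * Lam = E1.
  apply: (block_ext Eg) => //; first by rewrite -mulrA LE.
  case=> [|i]; rewrite -mulrA Lg /l0 /E1 mulrBl (EgE _).1.
    by rewrite mulr0 gg subrr.
  rewrite go // subr0 -gl mulrA Kg; by have [_ _ _ _ []] := kl i.
have HL : H * Lam = Lam.
  apply: (block_ext Eg) => //; first by rewrite -mulrA LE.
  move=> i; rewrite -mulrA Lg; case: i => [|i]; rewrite /l0 ?mulr0 //.
  by have [_ _ hl _ _] := kl i; rewrite -gl mulrA (bdE Eg bdP _ hB) gl hl.
have E1K : E1 * Kap = Kap by rewrite -KL -mulrA LK KapH.
have LE1 : Lam * E1 = Lam by rewrite -KL mulrA LK HL.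
have E1E1 : E1 * E1 = E1 by rewrite -{2}KL mulrA E1K KL.
have fH : f * H = H /\ H * f = H.
  by split; [rewrite -EH.1 mulrA fE|rewrite -EH.2 -mulrA Ef].
have fE1 : f * E1 = E1 /\ E1 * f = E1.
  by split; [rewrite -EE1 mulrA fE|rewrite -E1E -mulrA Ef].
(* [Kap] is an isomorphism from [HR] to [E1 R], so the complements in [f] have equal rank; an
   isomorphism between them completes [Kap] to a unit [c] of [fRf]. *)
have [k' [l' [k'1 k'2 l'1 l'2 [lk' kl']]]] : eqv (f - H) (f - E1).
  have [i1 _ _] := idem_sub ff HH fH.1 fH.2.
  have [i2 _ _] := idem_sub ff E1E1 fE1.1 fE1.2.
  apply: (rk_eqv Rirr Rcont rkP i1 i2).
  rewrite (rk_sub rkP) ?(rk_sub rkP ff E1E1) ?fH ?fE1 //; try by case: fH.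
    congr (_ - _); apply: (eqv_rk rkP); by exists Kap, Lam.
  by case: fE1. by case: fE1.
have HfH : H * (f - H) = 0 by rewrite mulrBr fH.2 HH subrr.
have fHH : (f - H) * H = 0 by rewrite mulrBl fH.1 HH subrr.
have E1f : E1 * (f - E1) = 0 by rewrite mulrBr fE1.2 E1E1 subrr.
have fE1_ : (f - E1) * E1 = 0 by rewrite mulrBl fE1.1 E1E1 subrr.
have k'H : k' * H = 0 by rewrite -k'2 -mulrA fHH mulr0.
have Lk' : Lam * k' = 0 by rewrite -LE1 -k'1 -mulrA (mulrA E1) E1f mul0r mulr0.
have Kl' : Kap * l' = 0 by rewrite -KapH -l'1 -mulrA (mulrA H) HfH mul0r mulr0.
have k'L : k' * Lam = 0 by rewrite -HL mulrA k'H mul0r.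
have l'K : l' * Kap = 0 by rewrite -l'2 -E1K -mulrA (mulrA (f - E1)) fE1_ mul0r mulr0.
have fK : f * Kap = Kap by rewrite -EK mulrA fE.
have Kf : Kap * f = Kap by rewrite -KE -mulrA Ef.
have fL : f * Lam = Lam by rewrite -EL mulrA fE.
have Lf : Lam * f = Lam by rewrite -LE -mulrA Ef.
have fk' : f * k' = k' by rewrite -k'1 mulrA mulrBr ff fE1.1.
have k'f : k' * f = k' by rewrite -k'2 -mulrA mulrBl ff fH.2.
have fl' : f * l' = l' by rewrite -l'1 mulrA mulrBr ff fH.1.
have l'f : l' * f = l' by rewrite -l'2 -mulrA mulrBl ff fE1.2.
pose c := Kap + k'; pose c' := Lam + l'.
have cc : cunit f c c'.
  split; rewrite /c /c' ?mulrDl ?mulrDr ?fK ?Kf ?fL ?Lf ?fk' ?k'f ?fl' ?l'f //.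
  rewrite LK Lk' l'K lk' KL Kl' k'L kl'; split; ncring.
have cH : c * H = Kap by rewrite /c mulrDl KapH k'H addr0.
have Lc : Lam * c = H by rewrite /c mulrDr LK Lk' addr0.
clearbody c c'; have [C HC] := fcb cc; exists C => d d' vs cd vsE.
have cdh i : cunit (g i) (d i + h' i) (d' i + h' i).
  have [[_ hh' hk kh <-] _ _ _ _] := half i.
  exact: cunitD.
split=> //; have := HC _ _ (blockf_cunit cdh).
set X := blockf _; set V := blockf (fun i => d' i + _); set Y := blockf _.
suff -> : X * c * V * c' = X * Y by [].
have [fc cf _ _ [ccf _]] := cc.
have vsg i : g i.+1 * vs i.+1 = vs i.+1 /\ vs i.+1 * g i.+1 = vs i.+1.
  have [gk _ _ lg _] := kl i; rewrite vsE !mulrA gk.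
  by split=> //; rewrite -mulrA lg.
pose vs0 i := if i is 0%N then g 0%N else vs i.
have vB : block_family g vs0 by case=> [|i] /=; [rewrite gg|exact: vsg].
have dB : block_family g (fun i => d' i - h i).
  move=> i; have [_ _ hd' d'h _] := cd i.
  rewrite mulrBr mulrBl (gh i).1 (gh i).2.
  have -> : g i * d' i = d' i by rewrite -hd' mulrA (gh i).1.
  by have -> : d' i * g i = d' i by rewrite -d'h -mulrA (gh i).2.
(* The deviation of [V] from [f]. It lives under [H], where [c] is [Kap], so conjugation by [c]
   turns [f + del] into [f + Kap * del * Lam], which is [Y]. *)
pose del := bd (fun i => d' i - h i).
have VE : V = f + del.
  have [_ ->] := blockf_elementary dB; congr blockf; apply/funext => i.
  by have [[_ _ _ _ <-] _ _ _ _] := half i; ncring.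
have YE : Y = f + Kap * del * Lam.
  rewrite /Y /blockf -/vs0; suff <- : E + Kap * del * Lam = bd vs0 by ncring.
  apply: (bd_ext Eg bdP) => //; first by rewrite mulrDl EE (mulE LE).
  case=> [|i]; rewrite mulrDl (EgE _).1 (mulE (Lg _)) /l0 /vs0 ?mulr0 ?addr0 //.
  rewrite -mulrA -(gl i) (mulrA del) (bdE Eg bdP _ dB) vsE.
  have [gk kh hl lg [lk klE]] := kl i; have [_ _ hd' d'h _] := cd i.
  have -> : Kap * ((d' i - h i) * l i) = k i * ((d' i - h i) * l i).
    have -> : (d' i - h i) * l i = g i * ((d' i - h i) * l i).
      by rewrite mulrA (dB i).1.
    by rewrite [LHS]mulrA Kg [RHS]mulrA kg.
  by rewrite mulrBl mulrBr hl klE mulrA addrC subrK.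
have Hdel : H * del = del.
  apply: bdMl => // i; have [_ _ hd' _ _] := cd i.
  by rewrite mulrBr hd' hh.
have delH : del * H = del.
  apply: bdMr => // i; have [_ _ _ d'h _] := cd i.
  by rewrite mulrBl d'h hh.
have cV : c * V = Y * c.
  rewrite VE YE mulrDr cf mulrDl fc; congr (_ + _).
  by rewrite -{1}Hdel mulrA cH -mulrA Lc -mulrA delH.
rewrite -(mulrA X) cV -!mulrA ccf; congr (_ * _).
by rewrite YE mulrDl ff -mulrA Lf.
Qed.

End Operators.
End BlockCommutators.

(** * Length bounds, from small corners to the whole ring *)

Section UnitLength.
Variables (K : realType) (R : unitRingType) (rk : R -> K).
Hypotheses (Rirr : irreducible_ring R) (Rcont : continuous_ring R).
Hypotheses (rkP : rank_function rk) (Rnd : ~ discrete_ring rk).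
Variable L : R -> K.
Hypothesis L_mul : forall x y, x \is a GRing.unit -> y \is a GRing.unit ->
  L (x * y) <= L x + L y.
Hypothesis L_inv : forall x, x \is a GRing.unit -> L x^-1 = L x.
Implicit Types a b c e f p q s t u v w x y z : R.

Lemma L_hatM_le f u v x y C D : cunit f u v -> cunit f x y ->
  L (hat f u) <= C -> L (hat f x) <= D -> L (hat f (u * x)) <= C + D.
Proof.
move=> cu cx uC xD; apply: (le_trans (L_hatM L_mul cu cx)).
exact: lerD.
Qed.

Lemma half_pair_exists e : e * e = e ->
  exists h h' s t, half_pair e h h' s t /\ rk h = rk e / 2.
Proof.
move=> ee; have [p [q [pp qq pq qp [pqe pqv]]]] := halving Rirr Rcont rkP Rnd ee.
have [s [t [qs sp pt tq [ts st]]]] := pqv.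
exists p, q, s, t; split=> //.
by rewrite -pqe (rk_add rkP) // -(eqv_rk rkP pqv); field.
Qed.

(** The blocks live in one half [F] of [f], the other half [Z] being kept free for the elementary
    factors; the first block has half the rank of [F], hence the quarter. In the product of the
    factorisations of all [us i] with the inverses of those for [i > 0], only the given unit in the
    first block survives, and each factor is bounded independently of it. *)
Lemma swindle f : f * f = f -> rk f <= 1 / 2 -> commutators_bounded L f ->
  exists p, [/\ p * p = p, rk p = rk f / 4 & bounded_on L p].
Proof.
move=> ff rf fcb.
have [F [Z [s0 [t0 [half0 rkF]]]]] := half_pair_exists ff.
have [[FF ZZ FZ ZF FZf] Zs0 s0F Ft0 [t0Z [ts0 _]]] := half0.
have [E [g [Eg FE EF rkg]]] := geometric_blocks Rirr Rcont rkP Rnd FF.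
have EgP := Eg; have [EE gg go EgE _] := EgP.
have fF : f * F = F by rewrite -FZf mulrDl FF ZF addr0.
have Ff : F * f = F by rewrite -FZf mulrDr FF FZ addr0.
have fZ : f * Z = Z by rewrite -FZf mulrDl FZ ZZ add0r.
have Zf : Z * f = Z by rewrite -FZf mulrDr ZF ZZ add0r.
have fE : f * E = E by rewrite -FE mulrA fF.
have Ef : E * f = E by rewrite -EF -mulrA Ff.
have rE : rk E <= 1 / 2.
  by rewrite -FE (le_trans (rk_mull rkP _ _)) // rkF; have := rk_ge0 rkP f; lra.
have [bd bdP] := block_operator Rirr Rcont rkP Eg rE.
have /boolp.choice[D DP] : forall i, exists d : (R * R) * (R * R),
    half_pair (g i) d.1.1 d.1.2 d.2.1 d.2.2 /\ rk d.1.1 = rk (g i) / 2.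
  move=> i; have [h [h' [s [t H]]]] := half_pair_exists (gg i).
  by exists ((h, h'), (s, t)).
pose h i := (D i).1.1; pose h' i := (D i).1.2.
pose s i := (D i).2.1; pose t i := (D i).2.2.
have half i : half_pair (g i) (h i) (h' i) (s i) (t i) by case: (DP i).
have /boolp.choice[M MP] : forall i, exists m : R * R,
    [/\ g i.+1 * m.1 = m.1, m.1 * h i = m.1, h i * m.2 = m.2,
      m.2 * g i.+1 = m.2 & m.2 * m.1 = h i /\ m.1 * m.2 = g i.+1].
  move=> i; have [[hh _ _ _ _] _ _ _ _] := half i.
  have [|k [l H]] := rk_eqv Rirr Rcont rkP hh (gg i.+1).
    by have [_ ->] := DP i; rewrite !rkg !exprS; field.
  by exists (k, l).
pose k i := (M i).1; pose l i := (M i).2.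
have kl i : [/\ g i.+1 * k i = k i, k i * h i = k i, h i * l i = l i,
  l i * g i.+1 = l i & l i * k i = h i /\ k i * l i = g i.+1] := MP i.
have hB : block_family g h.
  move=> i; have [[hh hh' hk kh <-] _ _ _ _] := half i.
  by rewrite mulrDl mulrDr hh kh hk addr0.
have h'B : block_family g h'.
  move=> i; have [[hh hh' hk kh <-] _ _ _ _] := half i.
  by rewrite mulrDl mulrDr hh' kh hk add0r.
pose H := bd h; pose H' := bd h'.
have [EH HE] := bd_corner Eg bdP hB; have [EH' H'E] := bd_corner Eg bdP h'B.
rewrite -/H in EH HE; rewrite -/H' in EH' H'E.
have bdM (p q r : nat -> R) : block_family g p -> block_family g q ->
    (forall i, p i * q i = r i) -> bd p * bd q = bd r.
  move=> pB qB pq; have [_ ->] := bd_mul Eg bdP pB qB.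
  by congr bd; apply/funext.
have bd0 : bd (fun=> 0) = 0.
  by apply/esym/(bd_ext Eg bdP) => [i||i]; rewrite ?mulr0 ?mul0r.
have HH : H * H = H by apply: bdM => // i; case: (half i) => -[].
have HH' : H' * H' = H' by apply: bdM => // i; case: (half i) => -[].
have HK : H * H' = 0.
  by rewrite -bd0; apply: bdM => // i; case: (half i) => -[].
have KH : H' * H = 0.
  by rewrite -bd0; apply: bdM => // i; case: (half i) => -[].
have fH : f * H = H by rewrite -EH mulrA fE.
have fH' : f * H' = H' by rewrite -EH' mulrA fE.
have Hf : H * f = H by rewrite -HE -mulrA Ef.
have H'f : H' * f = H' by rewrite -H'E -mulrA Ef.
have FH : F * H = H by rewrite -EH mulrA FE.
have HF : H * F = H by rewrite -HE -mulrA EF.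
have FH' : F * H' = H' by rewrite -EH' mulrA FE.
have H'F : H' * F = H' by rewrite -H'E -mulrA EF.
have ZH : Z * H = 0 by rewrite -FH mulrA ZF mul0r.
have ZH' : Z * H' = 0 by rewrite -FH' mulrA ZF mul0r.
have HZ : H * Z = 0 by rewrite -HF -mulrA FZ mulr0.
have H'Z : H' * Z = 0 by rewrite -H'F -mulrA FZ mulr0.
(* [s0] and [t0], cut down by [B], identify [BR] with a part of the free half [Z]. *)
have elem A B : A * A = A -> B * B = B -> B * A = 0 -> f * A = A -> B * f = B ->
    Z * A = 0 -> B * Z = 0 -> F * B = B -> B * F = B ->
    exists C, forall a, A * a = a -> a * B = a -> L (hat f (f + a)) <= C.
  move=> AA BB BA fA Bf ZA BZ FB BF.
  apply: (@commutator_elementary _ R L f A B Z (s0 * B) (B * t0)) => //.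
  - by rewrite mulrA Zs0.
  - by rewrite -mulrA BB.
  - by rewrite mulrA BB.
  - by rewrite -mulrA t0Z.
  - by rewrite mulrA -(mulrA B) ts0 BF BB.
have [C1 C1P] := elem H H' HH HH' KH fH H'f ZH H'Z FH' H'F.
have [C2 C2P] := elem H' H HH' HH HK fH' Hf ZH' HZ FH HF.
have [C3 C3P] := swap_commutator_bound ff fE Ef Eg bdP half fcb.
have [C4 C4P] := shift_commutator_bound Rirr Rcont rkP ff fE Ef Eg bdP half kl fcb.
exists (g 0%N); split=> //; first by rewrite rkg rkF expr1; field.
exists (C1 + C2 + C1 + C3 + C4) => u v cu.
have [us [vs [Q [us0 vs0 cuv QP usS]]]] := swindle_sequence Rirr Rcont rkP half kl cu.
pose a i := (Q i).1.1.1.1; pose b i := (Q i).1.1.1.2; pose c i := (Q i).1.1.2.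
pose z i := (Q i).1.2.1; pose z' i := (Q i).1.2.2.
pose d i := (Q i).2.1; pose d' i := (Q i).2.2.
have QE i : [/\ [/\ h i * a i = a i, a i * h' i = a i, h' i * b i = b i & b i * h i = b i],
      h i * c i = c i /\ c i * h' i = c i, cunit (h i) (z i) (z' i),
      cunit (h i) (d i) (d' i)
    & us i = (g i + a i) * (g i + b i) * (g i + c i) * (z' i + s i * z i * t i) * (d i + h' i)].
  have := QP i; rewrite /swindle_data /a /b /c /z /z' /d /d'.
  by case: (Q i) => [[[[? ?] ?] [? ?]] [? ?]].
clearbody a b c z z'.
have cz i : cunit (h i) (z i) (z' i) by case: (QE i).
have cd i : cunit (h i) (d i) (d' i) by case: (QE i).
have vsS i : vs i.+1 = k i * d' i * l i by have [_ ->] := usS i.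
clearbody d d'.
have fam (p q e : nat -> R) : block_family g p -> block_family g q ->
    (forall i, p i * e i = e i) -> (forall i, e i * q i = e i) -> block_family g e.
  move=> pB qB pe eq i; split; first by rewrite -pe mulrA (pB i).1.
  by rewrite -eq -mulrA (qB i).2.
have aB : block_family g a.
  by apply: (fam h h') => // i; case: (QE i) => -[].
have bB : block_family g b.
  by apply: (fam h' h) => // i; case: (QE i) => -[].
have cB : block_family g c.
  by apply: (fam h h') => // i; case: (QE i) => _ [].
have elemP (p q : nat -> R) (pB : block_family g p) (qB : block_family g q)
      (e : nat -> R) :
    block_family g e -> bd q * bd p = 0 ->
    (forall i, p i * e i = e i) -> (forall i, e i * q i = e i) ->
    [/\ bd p * bd e = bd e, bd e * bd q = bd e
      & exists w, cunit f (f + bd e) w].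
  move=> eB qp pe eq; have pbe : bd p * bd e = bd e by apply: bdM.
  have ebq : bd e * bd q = bd e by apply: bdM.
  split=> //; exists (f - bd e); have [Ee eE] := bd_corner Eg bdP eB.
  apply: cunit_elementary => //.
  - by rewrite -Ee mulrA fE.
  - by rewrite -eE -mulrA Ef.
  by rewrite -{1}ebq -{2}pbe -mulrA (mulrA (bd q)) qp mul0r mulr0.
have [||a1 a2 [wa ca]] := elemP h h' hB h'B a aB KH.
- by move=> i; case: (QE i) => -[].
- by move=> i; case: (QE i) => -[].
have [||b1 b2 [wb cb]] := elemP h' h h'B hB b bB HK.
- by move=> i; case: (QE i) => -[].
- by move=> i; case: (QE i) => -[].
have [||c1 c2 [wc cc]] := elemP h h' hB h'B c cB KH.
- by move=> i; case: (QE i) => _ [].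
- by move=> i; case: (QE i) => _ [].
have [cq Lq] := C3P _ _ cz.
have [cdh Ld] := C4P _ _ _ cd vsS.
(* The inverses of the [us i], but the identity in block 0: they cancel every block except the
   first. *)
pose w0 i := if i is 0%N then g 0%N else vs i.
pose w1 i := if i is 0%N then g 0%N else us i.
have cw i : cunit (g i) (w0 i) (w1 i).
  by case: i => [|i]; [exact: cunit1|exact: cunit_sym (cuv i.+1)].
have [gaB aE] := blockf_elementary f Eg bdP aB.
have [gbB bE] := blockf_elementary f Eg bdP bB.
have [gcB cE] := blockf_elementary f Eg bdP cB.
have qB : block_family g (fun i => z' i + s i * z i * t i).
  by move=> i; case: (cq i).
have dhB : block_family g (fun i => d i + h' i) by move=> i; case: (cdh i).
have w0B : block_family g w0 by move=> i; case: (cw i).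
pose u0 i := if i is 0%N then u else g i.
have u0B : block_family g u0.
  by case=> [|i] /=; [case: cu|rewrite gg].
have hatE : hat (g 0%N) u = hat f ((f + bd a) * (f + bd b) * (f + bd c) *
    blockf f E bd (fun i => z' i + s i * z i * t i) *
    (blockf f E bd (fun i => d i + h' i) * blockf f E bd w0)).
  have bM := blockf_mul ff fE Ef Eg bdP.
  have [ab _] := bd_mul Eg bdP gaB gbB.
  have [abc _] := bd_mul Eg bdP ab gcB.
  have [abcq _] := bd_mul Eg bdP abc qB.
  have [abcqd _] := bd_mul Eg bdP abcq dhB.
  rewrite aE bE cE mulrA !bM //.
  have -> : (fun i => (g i + a i) * (g i + b i) * (g i + c i) *
      (z' i + s i * z i * t i) * (d i + h' i) * w0 i) = u0.
    apply/funext => i; have [_ _ _ _ <-] := QE i.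
    case: i => [|i]; rewrite /w0 /u0.
      by rewrite us0; case: cu.
    by case: (cuv i.+1) => _ _ _ _ [].
  rewrite /hat /blockf; suff <- : u + (E - g 0%N) = bd u0 by ncring.
  have [gu ug _ _ _] := cu.
  apply: (bd_ext Eg bdP) => //.
    by rewrite mulrDl mulrBl EE (EgE 0%N).2 -{1}ug -mulrA (EgE 0%N).2 ug.
  case=> [|i]; rewrite mulrDl mulrBl (EgE _).1.
    by rewrite gg subrr addr0 ug.
  by rewrite go // subr0 -ug -mulrA go // mulr0 add0r.
rewrite hatE.
have cQ := blockf_cunit ff fE Ef Eg bdP cq.
have cD := cunitM (blockf_cunit ff fE Ef Eg bdP cdh) (blockf_cunit ff fE Ef Eg bdP cw).
apply: (L_hatM_le (cunitM (cunitM (cunitM ca cb) cc) cQ) cD) => //.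
apply: (L_hatM_le (cunitM (cunitM ca cb) cc) cQ) => //.
apply: (L_hatM_le (cunitM ca cb) cc); last exact: C1P.
by apply: (L_hatM_le ca cb); [exact: C1P|exact: C2P].
Qed.

(** Idempotents of equal rank are conjugate in [R], since their complements have equal rank too; the
    conjugating unit [c] depends only on [p] and [q]. *)
Lemma bounded_on_eqv p q : p * p = p -> q * q = q -> rk p = rk q ->
  bounded_on L p -> bounded_on L q.
Proof.
move=> pp qq rpq [N NP].
have p'p' : (1 - p) * (1 - p) = 1 - p by rewrite !ncE pp; ncring.
have q'q' : (1 - q) * (1 - q) = 1 - q by rewrite !ncE qq; ncring.
have [s [t [qs sp pt tq [ts st]]]] := rk_eqv Rirr Rcont rkP pp qq rpq.
have [|s' [t' [q's' s'p' p't' t'q' [ts' st']]]] :=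
  rk_eqv Rirr Rcont rkP p'p' q'q'.
  by rewrite !rk_compl // rpq.
have p0 : (1 - p) * p = 0 by rewrite mulrBl mul1r pp subrr.
have p1 : p * (1 - p) = 0 by rewrite mulrBr mulr1 pp subrr.
have q0 : (1 - q) * q = 0 by rewrite mulrBl mul1r qq subrr.
have q1 : q * (1 - q) = 0 by rewrite mulrBr mulr1 qq subrr.
have s't : s' * t = 0 by rewrite -s'p' -pt -mulrA (mulrA (1 - p)) p0 mul0r mulr0.
have st'0 : s * t' = 0 by rewrite -sp -p't' -mulrA (mulrA p) p1 mul0r mulr0.
have t's : t' * s = 0 by rewrite -t'q' -qs -mulrA (mulrA (1 - q)) q0 mul0r mulr0.
have ts'0 : t * s' = 0 by rewrite -tq -q's' -mulrA (mulrA q) q1 mul0r mulr0.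
pose c := s + s'; pose c' := t + t'.
have cc' : c * c' = 1 by rewrite /c /c' !ncE st st' s't st'0; ncring.
have c'c : c' * c = 1 by rewrite /c /c' !ncE ts ts' t's ts'0; ncring.
have E1 : c * t = q by rewrite /c mulrDl st s't addr0.
have E2 : s * c' = q by rewrite /c' mulrDr st st'0 addr0.
have E3 : c * p = s.
  by rewrite /c mulrDl sp -s'p' -mulrA p0 mulr0 addr0.
clearbody c c'.
have Uc : c \is a GRing.unit by apply/unitrP; exists c'.
have c'E : c^-1 = c' by rewrite -[LHS]mulr1 -cc' mulKr.
exists (L c + N + L c) => u v cu.
have cu' := cunit_transport pt tq qs sp st ts cu.
have [Uw _] := hat_inv cu'.
have hE : hat q u = c * hat p (t * u * s) * c^-1.
  have [qu uq _ _ _] := cu.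
  by rewrite c'E /hat !ncE E1 E3 cc' (mulE E2) E2 qu uq.
have Uc' : c^-1 \is a GRing.unit by rewrite unitrV.
have Ucw : c * hat p (t * u * s) \is a GRing.unit by rewrite unitrMl.
rewrite hE; apply: (le_trans (L_mul Ucw Uc')); rewrite (L_inv Uc) lerD2r.
by apply: (le_trans (L_mul Uc Uw)); rewrite lerD2l; apply: NP cu'.
Qed.

Definition bounded_on_rank (r : K) :=
  forall e, e * e = e -> rk e = r -> bounded_on L e.

Lemma bounded_on_rank1 p : p * p = p -> bounded_on L p -> bounded_on_rank (rk p).
Proof. by move=> pp Bp e ee re; apply: bounded_on_eqv Bp. Qed.

Lemma unipotent_unit a : a * a = 0 -> 1 + a \is a GRing.unit.
Proof.
move=> aa; apply/unitrP; exists (1 - a).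
by split; rewrite !ncE aa; ncring.
Qed.

Lemma unipotent_add a b A B : a * a = 0 -> b * b = 0 -> a * b = 0 ->
  L (1 + a) <= A -> L (1 + b) <= B -> L (1 + (a + b)) <= A + B.
Proof.
move=> aa bb ab LA LB.
have -> : 1 + (a + b) = (1 + a) * (1 + b) by rewrite !ncE ab; ncring.
apply: le_trans (L_mul (unipotent_unit aa) (unipotent_unit bb)) _.
exact: lerD.
Qed.

(** The corner of [p + q] has rank [2 * r], out of reach of the hypothesis. Halving [p] and [q] cuts
    [a] into four pieces, each in a corner of rank [r]; products of pieces vanish, so [1 + a] is a
    product of four bounded unipotents. *)
Lemma elementary_bounded r p q : bounded_on_rank r -> p * p = p -> q * q = q ->
  p * q = 0 -> q * p = 0 -> rk p = r -> rk q = r ->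
  exists C, forall a, p * a = a -> a * q = a -> L (1 + a) <= C.
Proof.
move=> Br pp qq pq qp rp rq.
have [p1 [p2 [s1 [t1 [hp rp1]]]]] := half_pair_exists pp.
have [q1 [q2 [s2 [t2 [hq rq1]]]]] := half_pair_exists qq.
have [[pp1 pp2 p12 p21 pE] ? ? ? [? [? ?]]] := hp.
have [[qq1 qq2 q12 q21 qE] ? ? ? [? [? ?]]] := hq.
have rp2 : rk p2 = rk p / 2.
  by rewrite -rp1; apply/esym/(eqv_rk rkP); exists s1, t1.
have rq2 : rk q2 = rk q / 2.
  by rewrite -rq1; apply/esym/(eqv_rk rkP); exists s2, t2.
have corner x y : x * x = x -> y * y = y -> p * x = x -> x * p = x ->
    q * y = y -> y * q = y -> rk x = r / 2 -> rk y = r / 2 ->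
    exists C, forall a, x * a = a -> a * y = a -> L (1 + a) <= C.
  move=> xx yy px xp qy yq rx ry.
  have xy : x * y = 0 by rewrite -xp -qy -mulrA (mulrA p) pq mul0r mulr0.
  have yx : y * x = 0 by rewrite -yq -px -mulrA (mulrA q) qp mul0r mulr0.
  have ee : (x + y) * (x + y) = x + y by rewrite !ncE xx yy xy yx; ncring.
  have [|C CP] := Br _ ee; first by rewrite (rk_add rkP) // rx ry; field.
  exists C => a xa ay.
  have ya : y * a = 0 by rewrite -xa mulrA yx mul0r.
  have ax : a * x = 0 by rewrite -ay -mulrA yx mulr0.
  have aa : a * a = 0 by rewrite -{1}ay -mulrA ya mulr0.
  have <- : hat (x + y) (x + y + a) = 1 + a by rewrite /hat; ncring.
  apply: (CP _ (x + y - a)); apply: cunit_elementary => //.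
    by rewrite mulrDl xa ya addr0.
  by rewrite mulrDr ax ay add0r.
have sub1 x y e : x * x = x -> y * y = y -> x * y = 0 -> y * x = 0 -> x + y = e ->
    [/\ e * x = x, x * e = x, e * y = y & y * e = y].
  by move=> xx yy xy yx <-; rewrite !mulrDl !mulrDr xx yy xy yx ?addr0 ?add0r.
have [e1 e2 e3 e4] := sub1 _ _ _ pp1 pp2 p12 p21 pE.
have [e5 e6 e7 e8] := sub1 _ _ _ qq1 qq2 q12 q21 qE.
rewrite rp in rp1 rp2; rewrite rq in rq1 rq2.
have [C1 CP1] := corner p1 q1 pp1 qq1 e1 e2 e5 e6 rp1 rq1.
have [C2 CP2] := corner p1 q2 pp1 qq2 e1 e2 e7 e8 rp1 rq2.
have [C3 CP3] := corner p2 q1 pp2 qq1 e3 e4 e5 e6 rp2 rq1.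
have [C4 CP4] := corner p2 q2 pp2 qq2 e3 e4 e7 e8 rp2 rq2.
exists (C1 + C2 + (C3 + C4)) => a pa aq.
have prod0 x y : p * x = x -> x * q = x -> p * y = y -> y * q = y -> x * y = 0.
  by move=> _ <- <- _; rewrite -mulrA (mulrA q) qp mul0r mulr0.
have -> : a = (p1 * a * q1 + p1 * a * q2) + (p2 * a * q1 + p2 * a * q2).
  by rewrite -!mulrDr qE -mulrDl -mulrDl pE pa aq.
have P i j : p * i = i -> j * q = j ->
    p * (i * a * j) = i * a * j /\ (i * a * j) * q = i * a * j.
  by move=> pi jq; rewrite !mulrA pi -(mulrA _ j q) jq.
have [P1 Q1] := P p1 q1 e1 e6; have [P2 Q2] := P p1 q2 e1 e8.
have [P3 Q3] := P p2 q1 e3 e6; have [P4 Q4] := P p2 q2 e3 e8.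
have PD x y : p * x = x -> p * y = y -> p * (x + y) = x + y.
  by move=> px py; rewrite mulrDr px py.
have QD x y : x * q = x -> y * q = y -> (x + y) * q = x + y.
  by move=> px py; rewrite mulrDl px py.
apply: unipotent_add; try by apply: prod0; auto.
  apply: unipotent_add; try by apply: prod0; auto.
    by apply: CP1; rewrite ?mulrA ?pp1 // -?mulrA ?qq1.
  by apply: CP2; rewrite ?mulrA ?pp1 // -?mulrA ?qq2.
apply: unipotent_add; try by apply: prod0; auto.
  by apply: CP3; rewrite ?mulrA ?pp2 // -?mulrA ?qq1.
by apply: CP4; rewrite ?mulrA ?pp2 // -?mulrA ?qq2.
Qed.

(** In the factorisation along two halves of [e] the diagonal units lie in corners of rank [r], and
    the three other factors are bounded by [elementary_bounded]. *)
Lemma bounded_on_double r : bounded_on_rank r -> bounded_on_rank (2 * r).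
Proof.
move=> Br e ee re.
have [h [h' [s [t [hp rh]]]]] := half_pair_exists ee.
have [[hh hh' hk kh hE] hs sh ht [th' [ts st]]] := hp.
have rh1 : rk h = r by rewrite rh re; field.
have rh' : rk h' = r by rewrite -rh1; apply/esym/(eqv_rk rkP); exists s, t.
have [C1 CP1] := elementary_bounded Br hh hh' hk kh rh1 rh'.
have [C2 CP2] := elementary_bounded Br hh' hh kh hk rh' rh1.
have [N1 NP1] := Br _ hh rh1; have [N2 NP2] := Br _ hh' rh'.
exists (C1 + C2 + C1 + (N1 + N2)) => u v cu.
have [a [b [c [x [x' [y [y' [[ha ah'] [hb bh] [hc ch'] [cx cy] ->]]]]]]]] :=
  GL2_decomposition Rirr Rcont rkP hh hh' hk kh hE cu.
have eh : e * h = h by rewrite -hE mulrDl hh kh addr0.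
have he : h * e = h by rewrite -hE mulrDr hh hk addr0.
have eh' : e * h' = h' by rewrite -hE mulrDl hh' hk add0r.
have h'e : h' * e = h' by rewrite -hE mulrDr hh' kh add0r.
have el p q z : q * p = 0 -> e * p = p -> q * e = q -> p * z = z -> z * q = z ->
    cunit e (e + z) (e - z) /\ hat e (e + z) = 1 + z.
  move=> qp ep qe pz zq; split; last by rewrite /hat; ncring.
  apply: cunit_elementary => //; first by rewrite -pz mulrA ep.
    by rewrite -zq -mulrA qe.
  by rewrite -{1}zq -{2}pz -mulrA (mulrA q) qp mul0r mulr0.
have [ca aE] := el _ _ _ kh eh h'e ha ah'.
have [cb bE] := el _ _ _ hk eh' he hb bh.
have [cc cE] := el _ _ _ kh eh h'e hc ch'.
have cxy := cunitD hk kh cx cy; rewrite hE in cxy.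
apply: (L_hatM_le (cunitM (cunitM ca cb) cc) cxy).
  apply: (L_hatM_le (cunitM ca cb) cc); last by rewrite cE; apply: CP1.
  by apply: (L_hatM_le ca cb); rewrite ?aE ?bE; [apply: CP1|apply: CP2].
have [hx xh _ _ _] := cx; have [h'y yh' _ _ _] := cy.
have -> : hat e (x + y) = hat h x * hat h' y.
  have xy : x * y = 0 by rewrite -xh -h'y -mulrA (mulrA h) hk mul0r mulr0.
  have xh' : x * h' = 0 by rewrite -xh -mulrA hk mulr0.
  have hy : h * y = 0 by rewrite -h'y mulrA hk mul0r.
  by rewrite /hat -hE !ncE xy xh' hy hk; ncring.
apply: le_trans (L_mul (hat_inv cx).1 (hat_inv cy).1) _.
by apply: lerD; [apply: NP1 cx|apply: NP2 cy].
Qed.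

Theorem unit_length_bounded : exists N, forall x, x \is a GRing.unit -> L x <= N.
Proof.
have [F [Z [s0 [t0 [half0 rkF]]]]] := half_pair_exists (mulr1 (1 : R)).
have [[FF _ _ _ _] _ _ _ _] := half0.
have rk1 : rk 1 = 1 by case: rkP.
rewrite rk1 in rkF.
have [E [g [Eg FE EF rkg]]] := geometric_blocks Rirr Rcont rkP Rnd FF.
have rE : rk E <= 1 / 2 by rewrite -rkF -FE rk_mull.
have [n [N full]] := full_block Rirr Rcont rkP L Eg rE.
have fcb := full_commutator L_mul L_inv full.
have [_ gg _ EgE _] := Eg.
have rg : rk (g n) <= 1 / 2.
  by rewrite -(EgE n).1 (le_trans (rk_mull rkP _ _)).
have [p [pp rp Bp]] := swindle (gg n) rg fcb.
have : forall m, bounded_on_rank (2 ^+ m * rk p).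
  elim=> [|m IH]; first by rewrite expr0 mul1r; apply: bounded_on_rank1.
  by rewrite exprS -mulrA; apply: bounded_on_double.
move=> /(_ (n + 4)%N).
(* [F] has rank 1/2, so the block [g n] has rank [2^-(n+2)], and the swindle divides this by 4. *)
have -> : 2 ^+ (n + 4) * rk p = 1.
  rewrite rp rkg rkF exprD (exprS _ n); field.
  by rewrite expf_neq0.
move=> /(_ 1 (mulr1 _) rk1)[M MP]; exists M => x Ux.
have := MP x x^-1; rewrite /hat subrr addr0; apply.
by split; rewrite ?mul1r ?mulr1 ?mulrV ?mulVr.
Qed.

End UnitLength.

(** * Fixed points of bounded orbits *)

Section GroupAction.
Variables (G : groupType) (X : Type) (act : G -> X -> X).
Hypothesis actP : group_action act.

Lemma actK g x : act g^-1%g (act g x) = x.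
Proof. by have [act1 actM] := actP; rewrite -actM mulVg act1. Qed.

Lemma actKV g x : act g (act g^-1%g x) = x.
Proof. by have [act1 actM] := actP; rewrite -actM mulgV act1. Qed.

End GroupAction.

(* The approximate circumcenters of a bounded orbit form a Cauchy sequence. *)
Section Circumcenter.
Variables (K : realType) (X : Type) (d : X -> X -> K).
Hypothesis d_ge0 : forall x y, 0 <= d x y.
Hypothesis d_eq0 : forall x y, d x y = 0 -> x = y.
Hypothesis d_sym : forall x y, d x y = d y x.
Hypothesis d_triangle : forall x y z, d x z <= d x y + d y z.
Hypothesis d_complete : forall u : nat -> X,
  (forall e, 0 < e -> exists N, forall m n, (N <= m)%N -> (N <= n)%N ->
    d (u m) (u n) < e) ->
  exists l, forall e, 0 < e -> exists n, forall m, (n <= m)%N -> d (u m) l < e.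
(** The inequality of Bruhat and Tits for a midpoint [m] of [p] and [q], common to CAT(0) and
    Hilbert spaces. *)
Hypothesis d_CN : forall p q, exists m, forall r,
  d m r ^+ 2 <= (d p r ^+ 2 + d q r ^+ 2) / 2 - d p q ^+ 2 / 4.

Variables (G : groupType) (act : G -> X -> X).
Hypothesis actP : isometric_action d act.

Lemma bounded_orbit_fixed_point x0 N :
  (forall g, d x0 (act g x0) <= N) -> has_fixed_point act.
Proof.
move=> orb; have [gact isom] := actP.
pose B x (c : K) := forall g, d x (act g x0) ^+ 2 <= c.
pose S := [set c | exists x, B x c].
have S0 : S !=set0.
  by exists (N ^+ 2); exists x0 => g; rewrite ler_pXn2r ?nnegrE // (le_trans _ (orb g)).
have Slb : lbound S 0.
  by move=> c [x /(_ 1%g)]; apply: le_trans; rewrite sqr_ge0.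
have Sinf : has_inf S by split=> //; exists 0.
pose r := inf S.
have rS c x : B x c -> r <= c.
  by move=> Bx; apply: ge_inf; [exists 0|exists x].
(* The midpoint of two centres for [c] is a centre for [c - d p q ^+ 2 / 4], which cannot be below
   the infimum [r]. *)
have gap p q c : B p c -> B q c -> d p q ^+ 2 <= 4 * (c - r).
  move=> Bp Bq; have [m mP] := d_CN p q.
  have : B m (c - d p q ^+ 2 / 4).
    move=> g; apply: (le_trans (mP _)); have := Bp g; have := Bq g; lra.
  by move=> /rS; lra.
have near n : exists x, B x (r + n.+1%:R^-1).
  have [|c [x Bx] cr] := @inf_adherent _ S n.+1%:R^-1 _ Sinf.
    by rewrite invr_gt0.
  exists x => g; apply: (le_trans (Bx g)); exact: ltW.
have /boolp.choice[u uP] := near.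
have arch (e : K) : 0 < e -> exists n, forall m, (n <= m)%N -> 4 * m.+1%:R^-1 < e ^+ 2.
  move=> e0; exists (Num.truncn (4 / e ^+ 2)) => m nm.
  rewrite ltr_pdivrMr ?ltr0n // mulrC -ltr_pdivrMr ?exprn_gt0 //.
  by apply: lt_le_trans (truncnS_gt _) _; rewrite ler_nat ltnS.
have uN n m : (n <= m)%N -> B (u m) (r + n.+1%:R^-1).
  move=> nm g; apply: (le_trans (uP m g)); rewrite lerD2l lef_pV2 ?posrE ?ltr0n //.
  by rewrite ler_nat ltnS.
have small (e : K) x y n : 0 < e -> 4 * n.+1%:R^-1 < e ^+ 2 ->
    B x (r + n.+1%:R^-1) -> B y (r + n.+1%:R^-1) -> d x y < e.
  move=> e0 ne Bx By; rewrite -(ltr_pXn2r (ltn0Sn 1)) ?nnegrE ?(ltW e0) //.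
  by apply: le_lt_trans (gap _ _ _ Bx By) _; rewrite addrAC subrr add0r.
have [|l lP] := d_complete (u := u).
  move=> e e0; have [n nP] := arch e e0; exists n => m k nm nk.
  by apply: (small e _ _ n) => //; [apply: nP|apply: uN|apply: uN].
exists l => g; apply/esym/d_eq0/eqP; rewrite eq_le d_ge0 andbT.
apply/ler_addgt0Pl => e e0; rewrite addr0.
have e3 : 0 < e / 3 by rewrite divr_gt0.
have [n1 H1] := arch _ e3; have [n2 H2] := lP _ e3.
pose n := maxn n1 n2.
(* The orbit is invariant, so [g] maps approximate centres to equally good ones, and [gap] keeps
   these close. *)
have Bg : B (act g (u n)) (r + n.+1%:R^-1).
  move=> h; have [_ actM] := gact.
  have -> : act h x0 = act g (act (g^-1 * h)%g x0) by rewrite -actM mulVKg.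
  by rewrite isom; apply: uP.
have D1 : d (u n) (act g (u n)) < e / 3.
  by apply: (small _ _ _ n) => //; apply: H1; rewrite leq_maxl.
have D2 : d (u n) l < e / 3 by apply: H2; rewrite leq_maxr.
have := d_triangle l (u n) (act g l).
have := d_triangle (u n) (act g (u n)) (act g l).
rewrite isom (d_sym l (u n)); lra.
Qed.

End Circumcenter.

(** * The midpoint inequality in CAT(0) and Hilbert spaces *)

Section CAT0.
Variable K : realType.

Definition point2 (x y : K) : 'rV[K]_2 := \row_j (if j == 0 then x else y).

Lemma eucl_dist_point2 (x1 y1 x2 y2 : K) :
  eucl_dist (point2 x1 y1) (point2 x2 y2) =
  Num.sqrt ((x1 - x2) ^+ 2 + (y1 - y2) ^+ 2).
Proof.
by rewrite /eucl_dist !big_ord_recl big_ord0 addr0 /point2 !mxE.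
Qed.

(** The law of cosines gives the foot [x] of the altitude, and the triangle inequalities give
    [x ^+ 2 <= b ^+ 2], so that the height exists. A degenerate base [c = 0] forces [a = b]. *)
Lemma comparison_triangle_exists (a b c : K) : 0 <= a -> 0 <= b -> 0 <= c ->
  a <= b + c -> b <= a + c -> c <= a + b ->
  exists x y, x ^+ 2 + y ^+ 2 = b ^+ 2 /\ (c - x) ^+ 2 + y ^+ 2 = a ^+ 2.
Proof.
move=> a0 b0 c0 abc bac cab; have [c_0|cn0] := eqVneq c 0.
  exists b, 0; have -> : a = b by lra.
  by rewrite c_0; split; ring.
have cp : 0 < c by rewrite lt_neqAle eq_sym cn0.
pose x := (b ^+ 2 + c ^+ 2 - a ^+ 2) / (2 * c).
have xc : 2 * c * x = b ^+ 2 + c ^+ 2 - a ^+ 2 by rewrite /x mulrC divfK // mulf_neq0.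
have xb : x ^+ 2 <= b ^+ 2.
  have x1 : - b <= x.
    by rewrite -(ler_pM2l (_ : 0 < 2 * c)) ?mulr_gt0 // xc; nra.
  have x2 : x <= b.
    by rewrite -(ler_pM2l (_ : 0 < 2 * c)) ?mulr_gt0 // xc; nra.
  by rewrite -subr_ge0 subr_sqr mulr_ge0 //; lra.
exists x, (Num.sqrt (b ^+ 2 - x ^+ 2)); rewrite sqr_sqrtr ?subr_ge0 //.
split; first by ring.
transitivity (c ^+ 2 - 2 * c * x + b ^+ 2); first by ring.
by rewrite xc; ring.
Qed.

Variable X : metricType K.
Hypothesis XC : CAT0 X.

(** The midpoint of the side from [p] to [q] is compared with [r], seen as the end of the side from
    [p] to [r]; in the plane the right-hand side is the squared length of the median. *)
Lemma CAT0_CN (p q : X) : exists m, forall r : X,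
  mdist m r ^+ 2 <= (mdist p r ^+ 2 + mdist q r ^+ 2) / 2 - mdist p q ^+ 2 / 4.
Proof.
have [geo cmp] := XC; have [c1 gc1] := geo p q.
have [c1p c1q c1d] := gc1; pose D := mdist p q.
have D0 : 0 <= D by exact: mdist_ge0.
have sI : D / 2 \in `[0, D] by rewrite in_itv /=; apply/andP; split; lra.
have I0 : 0 \in `[0, D] by rewrite in_itv /= lexx.
have I1 : D \in `[0, D] by rewrite in_itv /= lexx D0.
exists (c1 (D / 2)) => r; have [c2 gc2] := geo p r; have [c2p c2r c2d] := gc2.
pose a := mdist q r; pose b := mdist p r.
have [a0 b0] : 0 <= a /\ 0 <= b by split; exact: mdist_ge0.
have [||||||x [y [xyb xya]]] := @comparison_triangle_exists a b D => //.
- by rewrite addrC /D (metric_sym p q); exact: metric_triangle.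
- by rewrite addrC; exact: metric_triangle.
- by rewrite addrC /a (metric_sym q r); exact: metric_triangle.
have sq (t : K) : 0 <= t -> Num.sqrt (t ^+ 2) = t by move=> t0; rewrite sqrtr_sqr ger0_norm.
have tri : comparison_triangle p q r (point2 0 0) (point2 D 0) (point2 x y).
  split; rewrite eucl_dist_point2.
  - rewrite -[RHS](sq D) //; congr Num.sqrt; ring.
  - rewrite -[RHS](sq a) // -xya; congr Num.sqrt; ring.
  - rewrite -[RHS](sq b) // -xyb; congr Num.sqrt; ring.
have tI : b \in `[0, b] by rewrite in_itv /= lexx b0.
have := cmp p q r c1 c2 _ _ _ gc1 gc2 tri (D / 2) b (point2 (D / 2) 0) (point2 x y) sI tI.
rewrite c2r => H; have {}H : mdist (c1 (D / 2)) r <= eucl_dist (point2 (D / 2) 0) (point2 x y).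
  apply: H; split; rewrite eucl_dist_point2.
  - rewrite -{1}c1p c1d // sub0r normrN ger0_norm ?divr_ge0 //.
    by rewrite -[RHS]sq ?divr_ge0 //; congr Num.sqrt; ring.
  - rewrite -{1}c1q c1d // -/D distrC ger0_norm; last by lra.
    rewrite -[RHS]sq; last by lra.
    congr Num.sqrt; ring.
  - rewrite -/b -[RHS](sq b) // -xyb; congr Num.sqrt; ring.
  - by rewrite !subrr mdistxx expr0n addr0 sqrtr0.
apply: (@le_trans _ _ (eucl_dist (point2 (D / 2) 0) (point2 x y) ^+ 2)).
  by rewrite ler_pXn2r // nnegrE ?mdist_ge0 // sqrtr_ge0.
rewrite eucl_dist_point2 sqr_sqrtr ?addr_ge0 ?sqr_ge0 // -/a -/b -/D -xyb -xya.
by rewrite le_eqVlt; apply/orP; left; apply/eqP; field.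
Qed.

End CAT0.

Lemma complete_space_seq (K : realType) (X : pseudoMetricType K) :
  complete_space X -> forall u : nat -> X,
  (forall e : K, 0 < e -> exists N, forall m n, (N <= m)%N -> (N <= n)%N ->
    ball (u m) e (u n)) ->
  exists l, forall e : K, 0 < e -> exists N, forall n, (N <= n)%N -> ball l e (u n).
Proof.
move=> Xc u uC; have [|l ul] := Xc (u @ \oo) _.
  apply: cauchy_exP => e e0; have [N NP] := uC e e0.
  by exists (u N), N => // n Nn; apply: NP.
exists l => e e0; have [N _ NP] : (u @ \oo) (ball l e) by apply: ul; apply: nbhsx_ballx.
by exists N => n Nn; apply: NP.
Qed.

Lemma CAT0_fixed_point (K : realType) (X : metricType K) (G : groupType)
    (act : G -> X -> X) (x0 : X) (N : K) : complete_space X -> CAT0 X ->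
  isometric_action (@mdist K X) act ->
  (forall g, mdist x0 (act g x0) <= N) -> has_fixed_point act.
Proof.
move=> Xc XC actP orb.
apply: (bounded_orbit_fixed_point _ _ _ _ _ (CAT0_CN XC) actP orb).
- exact: mdist_ge0.
- exact: mdist_positivity.
- exact: metric_sym.
- by move=> x y z; exact: metric_triangle.
move=> u uC; have [|l lP] := complete_space_seq Xc (u := u).
  move=> e e0; have [n nP] := uC e e0; exists n => m k nm nk.
  by rewrite ballEmdist /=; apply: nP.
exists l => e e0; have [n nP] := lP e e0; exists n => m nm.
by have := nP m nm; rewrite ballEmdist /= metric_sym.
Qed.

Lemma Hilbert_fixed_point (K : realType) (H : completeNormedModType K)
    (ip : {dot H for idfun}) (G : groupType) (act : G -> H -> H) (N : K) :
  (forall x : H, ip x x = `|x| ^+ 2) ->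
  isometric_action (fun x y : H => `|x - y|) act ->
  (forall g, `|0 - act g 0| <= N) -> has_fixed_point act.
Proof.
move=> ipn actP orb.
apply: (bounded_orbit_fixed_point _ _ _ _ _ _ actP orb).
- by move=> x y; exact: normr_ge0.
- by move=> x y /normr0_eq0/eqP; rewrite subr_eq0 => /eqP.
- by move=> x y; exact: distrC.
- by move=> x y z; exact: ler_distD.
- move=> u uC; have Hc : complete_space H by move=> F FF /cauchy_cvg/cvg_ex.
  have [|l lP] := complete_space_seq Hc (u := u).
    move=> e e0; have [n nP] := uC e e0; exists n => m k nm nk.
    by rewrite -ball_normE /=; apply: nP.
  exists l => e e0; have [n nP] := lP e e0; exists n => m nm.
  by have := nP m nm; rewrite -ball_normE /= distrC.
(* The parallelogram law; it makes the midpoint inequality an equality. *)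
have par (x y : H) :
    `|x + y| ^+ 2 = 2 * (`|x| ^+ 2 + `|y| ^+ 2) - `|x - y| ^+ 2.
  rewrite -!ipn linearDl linearBl !linearDr !linearNr /=; ring.
move=> p q; exists (2^-1 *: (p + q)) => r.
pose x := p - r; pose y := q - r.
have -> : 2^-1 *: (p + q) - r = 2^-1 *: (x + y).
  rewrite /x /y addrACA -opprD scalerBr -mulr2n -(scaler_nat 2 r) scalerA mulVf //.
  by rewrite scale1r.
have -> : p - q = x - y by rewrite /x /y opprB addrA subrK.
rewrite normrZ exprMn par ger0_norm ?invr_ge0 // -/x -/y.
by rewrite le_eqVlt; apply/orP; left; apply/eqP; field.
Qed.

(** * Bounded orbits in trees *)

Section Tree.
Variables (V : eqType) (e : rel V).
Hypothesis eT : is_tree e.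
Implicit Types (x y v w m a : V) (p q : seq V).

Let e_irr : irreflexive e. Proof. by case: eT. Qed.
Let e_sym : symmetric e. Proof. by case: eT. Qed.

Definition walk x y n := exists p, [/\ path e x p, last x p = y & size p = n].

Lemma walk_exists x y : exists n, `[< walk x y n >].
Proof.
have [_ _ _ con _] := eT; have [p ep lp] := con x y.
by exists (size p); apply/asboolP; exists p.
Qed.

Definition gdist x y := ex_minn (walk_exists x y).

Lemma gdist_walk x y : walk x y (gdist x y).
Proof. by rewrite /gdist; case: ex_minnP => n /asboolP. Qed.

Lemma gdist_le x y n : walk x y n -> (gdist x y <= n)%N.
Proof.
by move=> W; rewrite /gdist; case: ex_minnP => k _; apply; apply/asboolP.
Qed.

Lemma walk_sym x y n : walk x y n -> walk y x n.
Proof.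
move=> [p [ep <- <-]]; exists (rev (belast x p)); split.
- rewrite rev_path; apply: sub_path ep => u v; by rewrite /= e_sym.
- by case: p {ep} => [//|z p] /=; rewrite rev_cons last_rcons.
by rewrite size_rev size_belast.
Qed.

Lemma walk_trans x y z n k : walk x y n -> walk y z k -> walk x z (n + k).
Proof.
move=> [p [ep lp <-]] [q [eq lq <-]]; exists (p ++ q).
by rewrite cat_path last_cat size_cat lp ep.
Qed.

Lemma gdist_sym x y : gdist x y = gdist y x.
Proof.
by apply/eqP; rewrite eqn_leq; apply/andP; split; apply: gdist_le;
   apply/walk_sym/gdist_walk.
Qed.

Lemma gdist_triangle x y z : (gdist x z <= gdist x y + gdist y z)%N.
Proof. by apply: gdist_le; apply: walk_trans; apply: gdist_walk. Qed.

Lemma gdist_eq0 x y : gdist x y = 0%N -> x = y.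
Proof.
by have := gdist_walk x y => -[p [_ lp sp]] H; move: lp; rewrite H in sp;
   rewrite (size0nil sp).
Qed.

(* Two such neighbours would be joined by a path through [a] avoiding [m],
   which closes up to a cycle through [m]. *)
Lemma unique_parent m n1 n2 a : e m n1 -> e m n2 ->
  (gdist n1 a <= gdist m a)%N -> (gdist n2 a <= gdist m a)%N -> n1 = n2.
Proof.
move=> e1 e2 d1 d2; apply/eqP/negPn/negP => n12.
have avoid n : (gdist n a <= gdist m a)%N -> e m n ->
    exists p, [/\ path e n p, last n p = a & m \notin n :: p].
  move=> dn en; have [p [ep lp sp]] := gdist_walk n a.
  exists p; split=> //; rewrite inE negb_or; apply/andP; split.
    by apply/negP => /eqP mn; move: en; rewrite mn e_irr.
  apply/negP => mp; case/splitPr: mp ep lp sp => q1 q2.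
  rewrite cat_path last_cat size_cat /= => /and3P[_ _ eq2] lq sz.
  have : (gdist m a <= size q2)%N by apply: gdist_le; exists q2.
  by lia.
have [p1 [ep1 lp1 mp1]] := avoid _ d1 e1.
have [p2 [ep2 lp2 mp2]] := avoid _ d2 e2.
pose p := p1 ++ rev (belast n2 p2).
have ep : path e n1 p.
  rewrite /p cat_path ep1 lp1 -lp2 rev_path; apply: sub_path ep2 => u v.
  by rewrite /= e_sym.
have lp : last n1 p = n2.
  rewrite /p last_cat lp1 -lp2.
  by case: (p2) => [//|z q] /=; rewrite rev_cons last_rcons.
have mp : m \notin n1 :: p.
  rewrite /p -cat_cons mem_cat mem_rev negb_or mp1 /=.
  by apply: contra mp2; apply: mem_belast.
have [_ _ _ _ acyclic] := eT; move: lp mp.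
case/shortenP: ep => q eq uq sub lq mp.
suff : (size (m :: n1 :: q) <= 2)%N.
  by case: q {eq uq sub mp} lq => [/= E|//]; rewrite E eqxx in n12.
apply: acyclic; rewrite /ucycle; apply/andP; split.
  by rewrite /= rcons_path e1 eq lq e_sym e2.
rewrite cons_uniq uq andbT; apply: contra mp.
by rewrite !inE => /orP[->//|/sub ->]; rewrite orbT.
Qed.

(* Leaving the parent behind, a simple path moves away from [a]. *)
Lemma gdist_climb p v m a : e m v -> (gdist v a <= gdist m a)%N ->
  path e m p -> uniq (v :: m :: p) ->
  (gdist m a + size p <= gdist (last m p) a)%N.
Proof.
elim: p v m => [|x p IH] v m emv dv /=; first by rewrite addn0.
move=> /andP[emx ep]; rewrite !inE !negb_or => /and3P[/and3P[vm vx vp] mxp uxp].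
have dx : (gdist m a < gdist x a)%N.
  rewrite ltnNge; apply/negP => dx.
  by move: vx; rewrite (unique_parent emv emx dv dx) eqxx.
have := IH m x; rewrite e_sym emx (ltnW dx) ep => /(_ isT isT isT).
rewrite /= inE negb_or; case/andP: mxp => mx mp; rewrite mx mp uxp => /(_ isT).
by lia.
Qed.

Variables (G : groupType) (act : G -> V -> V).
Hypothesis actP : group_action act.
Hypothesis act_e : forall g x y, e (act g x) (act g y) = e x y.

Lemma walk_act g x y n : walk x y n -> walk (act g x) (act g y) n.
Proof.
move=> [p [ep <- <-]]; exists (map (act g) p).
rewrite size_map last_map; split=> //.
by rewrite path_map; apply: sub_path ep => u v; rewrite /= act_e.
Qed.

Lemma gdist_act g x y : gdist (act g x) (act g y) = gdist x y.
Proof.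
apply/eqP; rewrite eqn_leq; apply/andP; split; apply: gdist_le.
  by apply: walk_act; apply: gdist_walk.
by have := walk_act g^-1%g (gdist_walk (act g x) (act g y)); rewrite !actK.
Qed.

(** The circumradius is an integer and so is attained. Distinct centres are adjacent; as there are
    no triangles, there are at most two, and the group permutes them. *)
Lemma tree_fixed_point x0 N : (forall g, gdist x0 (act g x0) <= N)%N ->
  has_fixed_point act \/ fixes_edge e act.
Proof.
move=> orb; have [_ actM] := actP.
pose B v n := forall g, (gdist v (act g x0) <= n)%N.
have ex : exists n, `[< exists v, B v n >].
  by exists N; apply/asboolP; exists x0.
have [n /asboolP[v Bv] min] := ex_minnP ex.
have Binv g w : B w n -> B (act g w) n.
  move=> Bw h; have -> : act h x0 = act g (act (g^-1 * h)%g x0).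
    by rewrite -actM mulVKg.
  by rewrite gdist_act.
have adj w1 w2 : B w1 n -> B w2 n -> w1 = w2 \/ e w1 w2.
  move=> B1 B2; have [_ _ _ con _] := eT; have [p ep lp] := con w1 w2.
  case/shortenP: ep lp => q eq uq _ lq.
  case: q eq uq lq => [|m [|x q]] eq uq lq; first by left.
    by right; move: eq lq => /= /andP[? _] <-.
  (* The vertex [m] after [w1] on a longer path is a better centre: an orbit point at distance at
     least [n] from [m] is no farther from [w1] than from [m], so climbing past [m] would take [w2]
     farther than [n] from it. For [n = 0] both centres are the orbit point, and the path would not
     be simple. *)
  have : exists2 k, (k < n)%N & B m k.
    case: n {min Bv Binv} B1 B2 => [|k] B1 B2.
      have at_a w : B w 0%N -> w = act 1%g x0.
        by move=> /(_ 1%g); rewrite leqn0 => /eqP/gdist_eq0.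
      have : w1 \in [:: m, x & q].
        by rewrite (at_a _ B1) -(at_a _ B2) -lq /= inE mem_last orbT.
      by move: uq => /andP[/negP].
    exists k => // g; rewrite leqNgt; apply/negP => dm.
    move: eq; rewrite /= => /andP[e1 eq].
    have d1 : (gdist w1 (act g x0) <= gdist m (act g x0))%N.
      exact: leq_trans (B1 g) dm.
    have := @gdist_climb (x :: q) w1 m (act g x0); rewrite e_sym e1 d1.
    move=> /(_ isT isT eq uq); rewrite /= in lq *; rewrite lq.
    have := B2 g; lia.
  move=> [k kn Bm]; have : (n <= k)%N.
    by apply: min; apply/asboolP; exists m.
  by rewrite leqNgt kn.
have [[w [Bw vw]]|noother] := pselect (exists w, B w n /\ v <> w); last first.
  left; exists v => g; apply: contrapT => gv; apply: noother.
  by exists (act g v); split; [apply: Binv|move=> E; apply: gv].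
right; exists v, w; have evw : e v w by case: (adj _ _ Bv Bw).
have two u : B u n -> u = v \/ u = w.
  move=> Bu; case: (adj _ _ Bu Bv) => [|euv]; first by left.
  case: (adj _ _ Bu Bw) => [|euw]; first by right.
  have [_ _ _ _ acyclic] := eT.
  have : (size [:: u; v; w] <= 2)%N; last by [].
  apply: acyclic; rewrite /ucycle /= euv evw e_sym euw /= !inE.
  have ne a b : e a b -> a != b.
    by move=> eab; apply/negP => /eqP E; move: eab; rewrite E e_irr.
  by rewrite negb_or !ne.
split=> // g; have gne : act g v <> act g w.
  by move=> E; apply: vw; rewrite -(actK actP g v) E (actK actP).
case: (two _ (Binv g _ Bv)) => E1; case: (two _ (Binv g _ Bw)) => E2; auto.
  by exfalso; apply: gne; rewrite E1 E2.
by exfalso; apply: gne; rewrite E1 E2.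
Qed.

End Tree.

(** * From length functions to fixed points *)

Lemma GL_length_bounded (K : realType) (R : unitRingType) (rk : R -> K)
    (l : GL R -> K) :
  irreducible_ring R -> continuous_ring R -> rank_function rk ->
  ~ discrete_ring rk ->
  (forall g h, l (g * h)%g <= l g + l h) -> (forall g, l g^-1%g = l g) ->
  exists N, forall g, l g <= N.
Proof.
move=> Rirr Rcont rkP Rnd lM lV.
(* The value 0 off the units is a dummy: the bound is asked on units only. *)
pose L (x : R) := if insub x is Some g then l g else 0.
have LE (g : GL R) : L (val g) = l g by rewrite /L valK.
have [||N NP] := @unit_length_bounded K R rk Rirr Rcont rkP Rnd L.
- move=> x y Ux Uy; have := lM (GLUnit Ux) (GLUnit Uy).
  by rewrite -!LE.
- by move=> x Ux; have := lV (GLUnit Ux); rewrite -!LE.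
by exists N => g; rewrite -LE; apply: NP; exact: valP.
Qed.

(** The displacement of [x0] is a length function: the triangle inequality gives subadditivity, and
    isometry gives invariance under inversion. *)
Lemma isometric_orbit_bounded (K : realType) (R : unitRingType) (rk : R -> K)
    (X : Type) (d : X -> X -> K) (act : GL R -> X -> X) x0 :
  irreducible_ring R -> continuous_ring R -> rank_function rk ->
  ~ discrete_ring rk ->
  (forall x y, d x y = d y x) -> (forall x y z, d x z <= d x y + d y z) ->
  isometric_action d act -> exists N, forall g, d x0 (act g x0) <= N.
Proof.
move=> Rirr Rcont rkP Rnd d_sym d_tri actP; have [gact isom] := actP.
have [_ actM] := gact.
apply: (GL_length_bounded Rirr Rcont rkP Rnd) => [g h|g].
  by apply: le_trans (d_tri _ (act g x0) _) _; rewrite actM isom.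
by rewrite -(isom g) (actKV gact) d_sym.
Qed.

Theorem corollary1p4 (K : realType) (R : unitRingType) (rk : R -> K)
    (Rirr : irreducible_ring R) (Rcont : continuous_ring R)
    (rkP : rank_function rk) (Rnd : ~ discrete_ring rk) :
  (forall X : metricType K, [set: X] !=set0 -> complete_space X -> CAT0 X ->
     forall act : GL R -> X -> X,
       isometric_action (@mdist K X) act -> has_fixed_point act)
  /\ property_FH K (GL R)
  /\ property_FA (GL R).
Proof.
split; [|split].
- move=> X [x0 _] Xc XC act actP.
  have [N orb] := isometric_orbit_bounded x0 Rirr Rcont rkP Rnd
    (@metric_sym _ X) (@metric_triangle _ X) actP.
  exact: CAT0_fixed_point Xc XC actP orb.
- move=> H ip ipn act actP.
  have [||N orb] := isometric_orbit_bounded 0 Rirr Rcont rkP Rnd _ _ actP.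
  + by move=> x y; exact: distrC.
  + by move=> x y z; exact: ler_distD.
  exact: Hilbert_fixed_point ipn actP orb.
move=> V e eT act actP act_e; have [_ _ [x0] _ _] := eT.
pose d x y : K := (gdist eT x y)%:R.
have dP : isometric_action d act.
  by split=> // g x y; rewrite /d gdist_act.
have [||N orb] := isometric_orbit_bounded x0 Rirr Rcont rkP Rnd _ _ dP.
- by move=> x y; rewrite /d gdist_sym.
- by move=> x y z; rewrite /d -natrD ler_nat gdist_triangle.
apply: (tree_fixed_point (eT := eT) actP act_e (x0 := x0) (N := Num.truncn N)) => g.
by rewrite -ltnS -(ltr_nat K); apply: le_lt_trans (orb g) (truncnS_gt _).
Qed.
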